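(* Let $m\geq 1$ be an integer, let $A$ be a set and let $H$ be a finitely generated subgroup of the free group $F_A$ on $A$. For a positive integer $d$, let $\mathbf{Ab}(d)$ be the pseudovariety of all finite abelian groups of exponent dividing $d$. Then: (i) $\mathrm{Cl}_{\mathbf{Ab}(m)}(H)=HF_A'F_A^m$; (ii) $\mathrm{Cl}_{\mathbf{Ab}(m)}(H)$ is finitely generated if and only if $A$ is finite; (iii) it is decidable whether or not $\mathrm{Cl}_{\mathbf{Ab}(m)}(H)$ is finitely generated; (iv) if $\mathrm{Cl}_{\mathbf{Ab}(m)}(H)$ is finitely generated, we can compute a basis of $\mathrm{Cl}_{\mathbf{Ab}(m)}(H)$; (v) it is decidable whether or not $H$ is $\mathbf{Ab}(m)$-closed; (vi) $H$ is $\mathbf{Ab}(m)$-dense if and only if $H$ is $\mathbf{Ab}(p)$-dense for every prime $p$ dividing $m$; (vii) it is decidable whether or not $H$ is $\mathbf{Ab}(m)$-dense; (viii) the membership problem for $\mathrm{Cl}_{\mathbf{Ab}(m)}(H)$ is decidable; (ix) if $A$ is finite, then we can define a recursively enumerable basis $B$ of $\mathrm{Cl}_{\mathbf{Ab}(m)}(H)$ and produce an algorithm which expresses any element of $\mathrm{Cl}_{\mathbf{Ab}(m)}(H)$ as a word on $B$.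
   Context: $F_A'=[F_A,F_A]$ is the derived subgroup of $F_A$ and $F_A^m=\langle u^m\mid u\in F_A\rangle$ is the subgroup generated by all $m$-th powers. A pseudovariety (of finite groups) is a class of finite groups closed under taking subgroups, homomorphic images and finitary direct products. For a pseudovariety $\mathbf{V}$, the pro-$\mathbf{V}$ topology on a group $G$ is the coarsest topology making all homomorphisms from $G$ to elements of $\mathbf{V}$ (with the discrete topology) continuous; equivalently, the normal subgroups $K$ of $G$ with $G/K\in\mathbf{V}$ form a basis of neighbourhoods of the identity. $\mathrm{Cl}_{\mathbf{V}}(H)$ denotes the closure of $H$ in the pro-$\mathbf{V}$ topology on $F_A$; $H$ is $\mathbf{V}$-closed if $\mathrm{Cl}_{\mathbf{V}}(H)=H$ and $\mathbf{V}$-dense if $\mathrm{Cl}_{\mathbf{V}}(H)=F_A$. Decidability and computability convention: the basis $A$ of the free group is fixed, and the input is a finite generating set of $H$, given as reduced words over $A\cup A^{-1}$. ''Basis'' of a subgroup means a free basis. *)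

(* Defs.v *)
From HB Require Import structures.
From mathcomp Require Import all_boot all_fingroup all_solvable.
From mathcomp Require Import boolp classical_sets cardinality topology.

Set Implicit Arguments.
Unset Strict Implicit.
Unset Printing Implicit Defensive.

Local Open Scope classical_set_scope.
Local Open Scope group_scope.

(** * Free groups: reduced words *)

(* The letter (a, false) stands for a and (a, true) for its formal inverse. *)
Section ReducedWords.
Context {A : choiceType}.
Implicit Types (x : A * bool) (u v w : seq (A * bool)).

Definition inv_letter x : A * bool := (x.1, ~~ x.2).

Definition reduced w : bool := sorted (fun x y => y != inv_letter x) w.

Definition cons_red x w : seq (A * bool) :=
  if w is y :: w' then if y == inv_letter x then w' else x :: w else [:: x].

Definition mul_word u v : seq (A * bool) := foldr cons_red v u.

Definition inv_word w : seq (A * bool) := rev [seq inv_letter x | x <- w].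

Lemma inv_letterK : involutive inv_letter.
Proof. by case=> a b; rewrite /inv_letter /= negbK. Qed.

Lemma reduced_cons_red x w : reduced w -> reduced (cons_red x w).
Proof.
case: w => //= y w; case: eqP => [_ /path_sorted //|/eqP yx yw /=].
by rewrite yx.
Qed.

Lemma reduced_mul u v : reduced v -> reduced (mul_word u v).
Proof. by move=> rv; elim: u => //= x u; exact: reduced_cons_red. Qed.

Lemma reduced_inv w : reduced w -> reduced (inv_word w).
Proof.
rewrite /reduced /inv_word rev_sorted sorted_map; apply: sub_sorted => x y /=.
by apply: contraNneq => ->; rewrite inv_letterK.
Qed.

Lemma cons_redK x w : reduced w -> cons_red x (cons_red (inv_letter x) w) = w.
Proof.
case: w => [|y w] /=; first by rewrite eqxx.
rewrite inv_letterK; case: eqP => [-> | _ _] /=; last by rewrite eqxx.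
by case: w => //= z w /andP[/negPf ->].
Qed.

Lemma mul_cons_red x u v :
  reduced v -> mul_word (cons_red x u) v = cons_red x (mul_word u v).
Proof.
move=> rv; case: u => //= y u; case: eqP => //= ->.
by rewrite cons_redK // reduced_mul.
Qed.

Lemma mul_wordA u v w :
  reduced w -> mul_word u (mul_word v w) = mul_word (mul_word u v) w.
Proof. by move=> rw; elim: u => //= x u ->; rewrite mul_cons_red. Qed.

Lemma mul_word1 u : reduced u -> mul_word u [::] = u.
Proof.
elim: u => //= x u IHu xu; rewrite IHu; last exact: path_sorted xu.
by case: u xu {IHu} => //= y u /andP[/negPf ->].
Qed.

Lemma mul_inv_word u v : mul_word (inv_word u) (u ++ v) = v.
Proof.
rewrite /mul_word /inv_word; elim: u v => //= x u IHu v.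
by rewrite rev_cons foldr_rcons /= inv_letterK eqxx IHu.
Qed.

Lemma inv_wordK : involutive inv_word.
Proof.
by move=> w; rewrite /inv_word map_rev revK -map_comp map_id_in // => x _;
  exact: inv_letterK.
Qed.

End ReducedWords.

Record freeGroup (A : choiceType) :=
  FreeGroup { word :> seq (A * bool); wordP : reduced word }.

Section FreeGroup.
Context {A : choiceType}.

HB.instance Definition _ := [isSub for @word A].
HB.instance Definition _ := [Choice of freeGroup A by <:].

Implicit Types u v w : freeGroup A.

Definition fg_one : freeGroup A := @FreeGroup A [::] isT.
Definition fg_mul u v : freeGroup A := FreeGroup (reduced_mul u (wordP v)).
Definition fg_inv u : freeGroup A := FreeGroup (reduced_inv (wordP u)).

Lemma fg_mulA : associative fg_mul.
Proof. by move=> u v w; apply: val_inj; rewrite /= mul_wordA ?wordP. Qed.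
Lemma fg_mul1 : left_id fg_one fg_mul.
Proof. by move=> u; apply: val_inj. Qed.
Lemma fg_mulr1 : right_id fg_one fg_mul.
Proof. by move=> u; apply: val_inj; rewrite /= mul_word1 ?wordP. Qed.
Lemma fg_mulV : left_inverse fg_one fg_inv fg_mul.
Proof.
move=> u; apply: val_inj => /=.
by have := mul_inv_word (word u) [::]; rewrite cats0.
Qed.
Lemma fg_mulrV : right_inverse fg_one fg_inv fg_mul.
Proof.
move=> u; rewrite -{1}[u](_ : fg_inv (fg_inv u) = u) ?fg_mulV //.
by apply: val_inj; rewrite /= inv_wordK.
Qed.

HB.instance Definition _ := isGroup.Build (freeGroup A)
  fg_mulA fg_mul1 fg_mulr1 fg_mulV fg_mulrV.

End FreeGroup.

(** * Subgroups *)

Section Subgroups.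
Context {G : groupType}.
Implicit Types (H K B : set G).

Definition subgroup H : Prop :=
  [/\ H 1, forall x y, H x -> H y -> H (x * y) & forall x, H x -> H x^-1].

Definition generated B : set G := smallest subgroup B.

Definition fin_gen H : Prop := exists X : seq G, H = generated [set` X].

Definition setmul H K : set G := [set x * y | x in H & y in K].

Definition derived : set G :=
  generated [set z | exists x y : G, z = [~ x, y]].

Definition powers (m : nat) : set G := generated [set x ^+ m | x in [set: G]].

Definition word_prod (s : seq (G * bool)) : G :=
  foldr (fun x z => (if x.2 then x.1^-1 else x.1) * z) 1 s.

Definition word_on B (s : seq (G * bool)) : Prop := forall x, x \in s -> B x.1.

Definition free_basis B H : Prop :=
  generated B = H /\
  forall s, reduced s -> word_on B s -> word_prod s = 1 -> s = [::].

End Subgroups.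

(** * Pseudovarieties and pro-V topologies *)

Record pseudovariety := Pseudovariety {
  pv_class :> finGroupType -> Prop;
  pv_trivial : forall gT : finGroupType, #|gT| = 1%N -> pv_class gT;
  pv_prod : forall gT rT : finGroupType,
    pv_class gT -> pv_class rT -> pv_class (gT * rT)%type;
  pv_sub : forall (gT : finGroupType) (K : {group gT}),
    pv_class gT -> pv_class (subg_of K);
  pv_quo : forall (gT rT : finGroupType) (f : {multiplicative gT -> rT}),
    (forall y, exists x, f x = y) -> pv_class gT -> pv_class rT
}.

Section AbelianExponent.
Variable d : nat.

Definition ab_class (gT : finGroupType) : Prop :=
  abelian [set: gT]%SET /\ (exponent [set: gT]%SET %| d)%N.

Lemma ab_classP (gT : finGroupType) :
  ab_class gT <-> commutative (@mulg gT) /\ forall x : gT, x ^+ d = 1.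
Proof.
split=> [[/centsP cG /exponentP eG]|[cG eG]]; split.
- by move=> x y; apply: cG; rewrite inE.
- by move=> x; apply: eG; rewrite inE.
- by apply/centsP => x _ y _; exact: cG.
- by apply/exponentP => x _; exact: eG.
Qed.

Fact ab_trivial (gT : finGroupType) : #|gT| = 1%N -> ab_class gT.
Proof.
move=> /eqP/fintype1P[z zP]; have eqz (x y : gT) : x = y by rewrite !zP.
by apply/ab_classP; split=> [x y|x]; exact: eqz.
Qed.

Fact ab_prod (gT rT : finGroupType) :
  ab_class gT -> ab_class rT -> ab_class (gT * rT)%type.
Proof.
move=> /ab_classP[cG eG] /ab_classP[cR eR]; apply/ab_classP; split.
  by move=> [x1 x2] [y1 y2]; congr (_, _) => /=; [exact: cG | exact: cR].
move=> [x y]; have -> : (x, y) ^+ d = (x ^+ d, y ^+ d).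
  by elim: (d) => // n IHn; rewrite !expgS IHn.
by rewrite eG eR.
Qed.

Fact ab_sub (gT : finGroupType) (K : {group gT}) :
  ab_class gT -> ab_class (subg_of K).
Proof.
move=> /ab_classP[cG eG]; apply/ab_classP; split=> [x y|x]; apply: val_inj.
  exact: cG.
by rewrite -[RHS](eG (val x)); elim: (d) => // n IHn; rewrite !expgS -IHn.
Qed.

Fact ab_quo (gT rT : finGroupType) (f : {multiplicative gT -> rT}) :
  (forall y, exists x, f x = y) -> ab_class gT -> ab_class rT.
Proof.
move=> f_surj /ab_classP[cG eG]; apply/ab_classP; split.
  move=> y1 y2; have [x1 <-] := f_surj y1; have [x2 <-] := f_surj y2.
  by rewrite -!gmulfM cG.
have f1 : f 1 = 1 by apply: (mulgI (f 1)); rewrite -gmulfM !mulg1.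
move=> y; have [x <-] := f_surj y; rewrite -f1 -(eG x).
by elim: (d) => // n IHn; rewrite !expgS IHn gmulfM.
Qed.

Definition Ab : pseudovariety :=
  Pseudovariety ab_trivial ab_prod ab_sub ab_quo.

End AbelianExponent.

(* G with its pro-V topology: the topology having as a subbase the preimages
   of arbitrary subsets under homomorphisms to groups in V. *)
Definition pro (V : pseudovariety) (G : groupType) : Type := G.

Section ProV.
Variables (V : pseudovariety) (G : groupType).

Definition pro_subbase : set (set G) :=
  [set U | exists gT : finGroupType, V gT /\
    exists (f : {multiplicative G -> gT}) (S : set gT), U = f @^-1` S].

HB.instance Definition _ := Choice.on (pro V G).
HB.instance Definition _ :=
  isSubBaseTopological.Build (pro V G) pro_subbase id.

Definition Cl (H : set G) : set G := closure (H : set (pro V G)).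

Definition Vclosed (H : set G) : Prop := Cl H = H.

Definition Vdense (H : set G) : Prop := Cl H = setT.

End ProV.

(** * Computability *)

(* Total recursive functions of several variables: the closure of the basic
   functions under composition, primitive recursion and minimisation of
   regular functions. *)
Inductive recursive : forall n : nat, (n.-tuple nat -> nat) -> Prop :=
| rec_zero n : @recursive n (fun=> 0%N)
| rec_succ : @recursive 1 (fun v => (thead v).+1)
| rec_proj n (i : 'I_n) : @recursive n (fun v => tnth v i)
| rec_comp n k (g : k.-tuple nat -> nat) (h : 'I_k -> n.-tuple nat -> nat) :
    recursive g -> (forall i, recursive (h i)) ->
    @recursive n (fun v => g [tuple h i v | i < k])
| rec_prim n (g : n.-tuple nat -> nat) (h : n.+2.-tuple nat -> nat) :
    recursive g -> recursive h ->
    @recursive n.+1 (fun v =>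
      nat_rect (fun=> nat) (g [tuple of behead v])
        (fun k r => h [tuple of k :: r :: behead v]) (thead v))
| rec_min n (g : n.+1.-tuple nat -> nat)
    (regular : forall v : n.-tuple nat,
      exists k : nat, g [tuple of k :: v] == 0%N) :
    recursive g -> @recursive n (fun v => ex_minn (regular v)).

(* Words are coded as numbers, given names e a : nat for the letters a. *)
Definition code_word (T : Type) (e : T -> nat) (w : seq (T * bool)) : nat :=
  CodeSeq.code [seq ((e x.1).*2 + nat_of_bool x.2)%N | x <- w].

Section Algorithms.
Context {A : choiceType}.
Local Notation F := (freeGroup A).
Implicit Types (e : A -> nat) (X : seq F) (w : F).

Definition code_elt e w : nat := code_word e w.

Definition code_elts e X : nat := CodeSeq.code [seq code_elt e w | w <- X].

Definition letters X : seq A := [seq x.1 | x <- flatten [seq word w | w <- X]].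

(* The input is a finite generating set X of the subgroup. As A may be
   uncountable, its letters have no fixed names: a single algorithm must give
   the right answer however distinct names are given to the letters occurring
   in the input. *)
Definition decidable_subgroups (P : set F -> Prop) : Prop :=
  exists f : 1.-tuple nat -> nat, recursive f /\
    forall X e, {in letters X &, injective e} ->
      f [tuple code_elts e X] = 1%N <-> P (generated [set` X]).

Definition decidable_membership (C : set F -> set F) : Prop :=
  exists f : 2.-tuple nat -> nat, recursive f /\
    forall X w e, {in letters (w :: X) &, injective e} ->
      f [tuple code_elts e X; code_elt e w] = 1%N <-> C (generated [set` X]) w.

(* The output may involve letters which do not occur in the input, so here the
   naming of all letters is fixed beforehand. *)
Definition computable_basis (P : set F -> Prop) (C : set F -> set F) : Prop :=
  forall e, injective e ->
  exists f : 1.-tuple nat -> nat, recursive f /\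
    forall X, P (generated [set` X]) ->
      exists B : seq F, [/\ f [tuple code_elts e X] = code_elts e B, uniq B &
        free_basis [set` B] (C (generated [set` X]))].

(* From X, enum lists the codes of the elements of B (a value k.+1 outputs k,
   while 0 outputs nothing, so that B may be empty), and expr rewrites each
   element of the subgroup as a word on B. *)
Definition re_basis_rewriting (C : set F -> set F) : Prop :=
  forall e, injective e ->
  exists enum expr : 2.-tuple nat -> nat, recursive enum /\ recursive expr /\
    forall X, exists B : set F,
      [/\ free_basis B (C (generated [set` X])),
          [set code_elt e b | b in B] =
            [set k | exists n : nat, enum [tuple code_elts e X; n] = k.+1] &
          forall w, C (generated [set` X]) w ->
            exists s : seq (F * bool),
              [/\ word_on B s, word_prod s = w &
                  expr [tuple code_elts e X; code_elt e w]
                    = code_word (code_elt e) s]].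

End Algorithms.

(* Main.v *)
From HB Require Import structures.
From mathcomp Require Import finmap all_boot all_fingroup all_algebra.
From mathcomp Require Import boolp classical_sets cardinality topology.
Require Import Defs.

(** Write N for the subgroup F'F^m. A homomorphism from F to an abelian group of
    exponent dividing m kills N, so nothing in HN can be separated from H by
    such homomorphisms. Conversely, an element lies in N as soon as its exponent
    sum at every letter vanishes modulo m ([verbalP]): modulo N it is the
    ordered product of its letters raised to their exponent sums. A finitely
    generated H and an element u involve only finitely many letters, and the
    exponent sums at these letters form a homomorphism to a finite group of row
    vectors that separates u from H whenever u is outside HN. Hence the closure
    of H is HN, and u belongs to it exactly when some h in H has the same
    exponent sums modulo m as u ([Cl_Ab], [Cl_AbP]). All the algorithms rest on
    this.

    Finite generation. If A is finite, N has finite index, and a subgroup of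
    finite index has a finite Schreier basis ([schreier_free_basis],
    [finite_schreier_basis]). Freeness of the Schreier generators is shown by
    the rewriting process: it is a homomorphism from the subgroup to the free
    group on the generators that sends each generator to itself. If a letter a
    occurs in none of finitely many generators, they cannot generate a^m
    ([verbal_letters]).

    Bases and rewriting. Over a finite alphabet the closure depends only on the
    set of exponent-sum vectors of the given generators, which takes finitely
    many values. So a basis is read from a finite table ([rows_basis]), and an
    element is rewritten by a transducer whose states are the vectors
    ([row_rewriting]).

    Membership and density. As exponent sums live modulo m, it is enough to
    compare those of the given word with those of the products of powers of the
    generators with exponents below m ([code_memberP]). Density means that every
    letter belongs to the closure ([code_denseP]). These tests, and the one for
    closedness, only compare names of letters with each other, so they do not
    depend on the naming. Density passes from the prime divisors of m to m
    because, modulo F', an equation u = h x^c with x = h' y^d gives u = h h'^c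
    y^(cd) ([dense_mod_primes]).

    Closedness. H is closed when it contains N, so over a finite alphabet it
    must be decided whether finitely many words lie in H. A word y outside H is
    recognized by a finite certificate: the letters act on the left cosets of H
    by injections, and restricting this action to the cosets of the suffixes of
    y and of the generators gives a partial action on few points that fixes the
    base point under the generators but not under y. Such a partial action
    cannot exist when y is in H, so a search among the finitely many partial
    actions decides ([code_in_subgroupP]).

    For the computations, [computable] extends recursiveness from numbers to
    countable types; it is closed under pairing, recursion on numbers and lists,
    and contains every function on a finite type ([computable_finfun]). *)

Set Implicit Arguments.
Unset Strict Implicit.
Unset Printing Implicit Defensive.

Import GRing.Theory.

(** * Recursive functions of numbers *)

Lemma recursive_ext n (f g : n.-tuple nat -> nat) :
  f =1 g -> recursive f -> recursive g.
Proof. by move=> /funext ->. Qed.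

Definition recursive1 (f : nat -> nat) : Prop :=
  @recursive 1 (fun v => f (thead v)).

Definition recursive2 (f : nat -> nat -> nat) : Prop :=
  @recursive 2 (fun v => f (thead v) (tnth v (@Ordinal 2 1 isT))).

Definition recursive3 (f : nat -> nat -> nat -> nat) : Prop :=
  @recursive 3 (fun v =>
    f (thead v) (tnth v (@Ordinal 3 1 isT)) (tnth v (@Ordinal 3 2 isT))).

Lemma recursive_comp1 n g (h : n.-tuple nat -> nat) :
  recursive1 g -> recursive h -> recursive (fun v => g (h v)).
Proof.
move=> g_rec h_rec.
apply: recursive_ext (rec_comp (h := fun=> h) g_rec (fun=> h_rec)) => v.
by rewrite /thead tnth_mktuple.
Qed.

Lemma recursive_comp2 n g (h1 h2 : n.-tuple nat -> nat) :
  recursive2 g -> recursive h1 -> recursive h2 ->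
  recursive (fun v => g (h1 v) (h2 v)).
Proof.
move=> g_rec h1_rec h2_rec.
pose h (i : 'I_2) := if val i is 0 then h1 else h2.
have h_rec i : recursive (h i) by case: i => -[|i].
apply: recursive_ext (rec_comp g_rec h_rec) => v.
by rewrite /thead !tnth_mktuple.
Qed.

Lemma recursive_comp3 n g (h1 h2 h3 : n.-tuple nat -> nat) :
  recursive3 g -> recursive h1 -> recursive h2 -> recursive h3 ->
  recursive (fun v => g (h1 v) (h2 v) (h3 v)).
Proof.
move=> g_rec h1_rec h2_rec h3_rec.
pose h (i : 'I_3) := match val i with 0 => h1 | 1 => h2 | _ => h3 end.
have h_rec i : recursive (h i) by case: i => -[|[|i]].
apply: recursive_ext (rec_comp g_rec h_rec) => v.
by rewrite /thead !tnth_mktuple.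
Qed.

Lemma recursive_succ : recursive1 succn.
Proof. exact: rec_succ. Qed.

Lemma recursive_const n c : @recursive n (fun=> c).
Proof.
elim: c => [|c IHc]; first exact: rec_zero.
exact: (recursive_comp1 recursive_succ IHc).
Qed.

Lemma recursive_prim1 c h :
  recursive2 h -> recursive1 (nat_rect (fun=> nat) c h).
Proof.
move=> h_rec.
apply: recursive_ext (rec_prim (recursive_const 0 c) h_rec) => v.
by elim: (thead v) => //= n ->; rewrite /thead !(tnth_nth 0).
Qed.

Lemma recursive_prim2 g h : recursive1 g -> recursive3 h ->
  recursive2 (fun n x => nat_rect (fun=> nat) (g x) (fun k r => h k r x) n).
Proof.
move=> g_rec h_rec.
apply: recursive_ext (rec_prim (n := 1) g_rec h_rec) => v.
have -> : tnth v (@Ordinal 2 1 isT) = thead [tuple of behead v].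
  by rewrite /thead !(tnth_nth 0) /= nth_behead.
by elim: (thead v) => //= n ->; rewrite /thead !(tnth_nth 0).
Qed.

Lemma recursive_thead n : recursive (fun v : n.+1.-tuple nat => thead v).
Proof. exact: (rec_proj ord0). Qed.

Lemma recursive1_iter f : recursive1 f -> recursive2 (fun n x => iter n f x).
Proof.
move=> f_rec.
have h_rec : recursive3 (fun _ r _ => f r).
  exact: recursive_comp1 f_rec (rec_proj (@Ordinal 3 1 isT)).
apply: recursive_ext (recursive_prim2 (g := id) (recursive_thead 0) h_rec) => v.
by elim: (thead v) => //= n ->.
Qed.

Definition if_zero (k x y : nat) : nat := if k is 0 then x else y.

Lemma recursive_if n (b f g : n.-tuple nat -> nat) :
  recursive b -> recursive f -> recursive g ->
  recursive (fun v => if_zero (b v) (f v) (g v)).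
Proof.
apply: recursive_comp3 => {n b f g}.
have if1_rec : recursive2 (fun k x => if_zero k 0 x).
  apply: recursive_ext (recursive_prim2 (g := fun=> 0) (h := fun _ _ x => x)
    (rec_zero 1) (rec_proj (@Ordinal 3 2 isT))) => v.
  by case: (thead v).
have if0_rec : recursive2 (fun k x => if_zero k x 0).
  apply: recursive_ext (recursive_prim2 (g := id) (h := fun _ _ _ => 0)
    (recursive_thead 0) (rec_zero 3)) => v.
  by case: (thead v).
have add_rec : recursive2 addn.
  apply: recursive_ext (recursive_prim2 (g := id) (h := fun _ r _ => r.+1)
    (recursive_thead 0)
    (recursive_comp1 recursive_succ (rec_proj (@Ordinal 3 1 isT)))) => v.
  by elim: (thead v) => //= n ->; rewrite addSn.
apply: (recursive_ext _ (recursive_comp2 add_rec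
  (recursive_comp2 if0_rec (recursive_thead 2) (rec_proj (@Ordinal 3 1 isT)))
  (recursive_comp2 if1_rec (recursive_thead 2)
                           (rec_proj (@Ordinal 3 2 isT))))) => v /=.
by case: (thead v) => [|k]; rewrite ?addn0.
Qed.

(** [CodeSeq.code] of a list, from its head and the code of its tail. *)
Definition code_cons (n c : nat) : nat := 2 ^ n * c.*2.+1.

Lemma recursive_double : recursive1 double.
Proof.
apply: recursive_ext (recursive_prim1 0 (h := fun _ r => r.+2)
  (recursive_comp1 recursive_succ
    (recursive_comp1 recursive_succ (rec_proj (@Ordinal 2 1 isT))))) => v.
by elim: (thead v) => //= n ->; rewrite doubleS.
Qed.

Lemma recursive_code_cons : recursive2 code_cons.
Proof.
apply: recursive_ext (recursive_comp2 (recursive1_iter recursive_double)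
  (recursive_thead 1) (recursive_comp1 recursive_succ
    (recursive_comp1 recursive_double (rec_proj (@Ordinal 2 1 isT))))) => v.
rewrite /code_cons.
by elim: (thead v) => [|n /= ->]; rewrite ?mul1n //= expnS -mulnA mul2n.
Qed.

Lemma recursive_odd : recursive1 (fun n => odd n).
Proof.
apply: recursive_ext (recursive_prim1 0 (h := fun _ r => if_zero r 1 0) _) =>
  [v|].
  by elim: (thead v) => //= n ->; case: (odd n).
by apply: recursive_if; first exact: (rec_proj (@Ordinal 2 1 isT));
  exact: recursive_const.
Qed.

Lemma recursive_half : recursive1 half.
Proof.
apply: recursive_ext (recursive_prim1 0
  (h := fun k r => if_zero (odd k) r r.+1) _) => [v|].
  by elim: (thead v) => //= n ->; rewrite uphalf_half; case: odd.
apply: recursive_if;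
  first exact: recursive_comp1 recursive_odd (recursive_thead 1).
  exact: (rec_proj (@Ordinal 2 1 isT)).
exact: (recursive_comp1 recursive_succ (rec_proj (@Ordinal 2 1 isT))).
Qed.

Lemma iter_half n c : iter n half c = c %/ 2 ^ n.
Proof.
elim: n => [|n IHn] /=; first by rewrite divn1.
by rewrite IHn -divn2 -divnMA expnSr.
Qed.

Definition code_head (c : nat) : nat := head 0 (CodeSeq.decode c).
Definition code_tail (c : nat) : nat := CodeSeq.code
  (behead (CodeSeq.decode c)).

Lemma code_headE n s : code_head (code_cons n (CodeSeq.code s)) = n.
Proof. by rewrite -[code_cons _ _]/(CodeSeq.code (n :: s)) /code_head
  CodeSeq.codeK. Qed.

Lemma code_tailE n s : code_tail (code_cons n (CodeSeq.code s)) = CodeSeq.code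
  s.
Proof. by rewrite -[code_cons _ _]/(CodeSeq.code (n :: s)) /code_tail
  CodeSeq.codeK. Qed.

Lemma half_code_cons n c : iter n half (code_cons n c) = c.*2.+1.
Proof. by rewrite iter_half /code_cons mulKn ?expn_gt0. Qed.

Lemma even_half_code_cons k n c : k < n ->
  odd (iter k half (code_cons n c)) = false.
Proof.
move=> lt_kn; rewrite iter_half /code_cons -(subnKC lt_kn) addSn -addnS expnD.
by rewrite -mulnA mulKn ?expn_gt0 // oddM expnS oddM.
Qed.

(** The first entry of a coded list is the least number of halvings that leaves
    an odd number; the code 0 of the empty list has none. *)
Lemma recursive_code_head : recursive1 code_head.
Proof.
pose g (v : 2.-tuple nat) := if_zero (tnth v (@Ordinal 2 1 isT)) 0
  (if_zero (odd (iter (thead v) half (tnth v (@Ordinal 2 1 isT)))) 1 0).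
have g_rec : recursive g.
  apply: recursive_if; first exact: (rec_proj (@Ordinal 2 1 isT)).
    exact: rec_zero.
  apply: recursive_if; try exact: recursive_const.
  apply: (recursive_comp1 recursive_odd (h := fun v => iter (thead v) half _)).
  exact: (recursive_comp2 (recursive1_iter recursive_half)
           (recursive_thead 1) (rec_proj _)).
have gE k (v : 1.-tuple nat) : g [tuple of k :: v] =
    if_zero (thead v) 0 (if_zero (odd (iter k half (thead v))) 1 0).
  by rewrite /g /thead !(tnth_nth 0).
have regular (v : 1.-tuple nat) : exists k, g [tuple of k :: v] == 0.
  exists (code_head (thead v)); rewrite gE.
  rewrite -[thead v]CodeSeq.decodeK; case: (CodeSeq.decode _) => [|n s] //.
  by rewrite -[CodeSeq.code (n :: s)]/(code_cons n _) code_headE half_code_cons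
    /= odd_double; case: code_cons.
apply: recursive_ext (rec_min regular g_rec) => v.
case: ex_minnP => k; rewrite gE => gk0 min_k.
have {}min_k j :
    if_zero (thead v) 0 (if_zero (odd (iter j half (thead v))) 1 0) == 0 ->
      k <= j.
  by rewrite -gE; exact: min_k.
move: gk0 min_k; rewrite -[thead v]CodeSeq.decodeK.
case: (CodeSeq.decode _) => [_ min_k | n s].
  by apply/eqP; rewrite -leqn0; apply: min_k.
rewrite -[CodeSeq.code (n :: s)]/(code_cons n _) code_headE => gk0 min_k.
apply/eqP; rewrite eqn_leq min_k /=; last first.
  by rewrite half_code_cons /= odd_double; case: code_cons.
rewrite leqNgt; apply/negP => /(even_half_code_cons (CodeSeq.code s)) e.
move: gk0; rewrite e;
  suff : 0 < code_cons n (CodeSeq.code s) by case: code_cons.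
by rewrite muln_gt0 expn_gt0.
Qed.

Lemma recursive_code_tail : recursive1 code_tail.
Proof.
apply: recursive_ext (recursive_comp1 recursive_half (recursive_comp2
  (recursive1_iter recursive_half)
  (recursive_comp1 recursive_code_head (recursive_thead 0))
  (recursive_thead 0))) => v.
rewrite -[thead v]CodeSeq.decodeK; case: (CodeSeq.decode _) => [|n s] //.
rewrite -[CodeSeq.code (n :: s)]/(code_cons n _) code_headE code_tailE
  half_code_cons /=.
exact: (half_bit_double _ true).
Qed.

(** * Computable functions between countable types *)

(** Computability is carried by codes: the recursive function is constrained
    only at the codes of elements of the domain. *)
Definition computable (S T : countType) (f : S -> T) : Prop :=
  exists2 g : nat -> nat, recursive1 g & forall x, g (pickle x) = pickle (f x).

Lemma pickle_nat (n : nat) : pickle n = n. Proof. by []. Qed.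

Lemma pickle_inj (T : countType) : injective (@pickle T).
Proof. exact: (pcan_inj pickleK). Qed.

Lemma pickle_cons (T : countType) (x : T) s :
  pickle (x :: s) = code_cons (pickle x) (pickle s).
Proof. by []. Qed.

Lemma pickle_pair (S T : countType) (x : S) (y : T) :
  pickle (x, y) = code_cons (pickle x) (code_cons (pickle y) 0).
Proof. by []. Qed.

Definition code_pair (a b : nat) : nat := code_cons a (code_cons b 0).

Lemma recursive_code_pair n (f g : n.-tuple nat -> nat) :
  recursive f -> recursive g -> recursive (fun v => code_pair (f v) (g v)).
Proof.
move=> f_rec g_rec; apply: (recursive_comp2 recursive_code_cons) => //.
by apply: (recursive_comp2 recursive_code_cons) => //; exact: recursive_const.
Qed.

Lemma computable_ext (E T : countType) (f g : E -> T) :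
  f =1 g -> computable f -> computable g.
Proof. by move=> /funext ->. Qed.

Lemma computable_id (E : countType) : computable (fun x : E => x).
Proof. by exists id; first exact: recursive_thead. Qed.

Lemma computable_const (E T : countType) (y : T) : computable (fun _ : E => y).
Proof. by exists (fun=> pickle y); first exact: recursive_const. Qed.

Lemma computable_comp (E S T : countType) (g : S -> T) (f : E -> S) :
  computable g -> computable f -> computable (fun x => g (f x)).
Proof.
move=> [g' g_rec gE] [f' f_rec fE]; exists (fun n => g' (f' n)).
  exact: (recursive_comp1 g_rec f_rec).
by move=> x; rewrite fE gE.
Qed.

Lemma computable_pair (E S T : countType) (f : E -> S) (g : E -> T) :
  computable f -> computable g -> computable (fun x => (f x, g x)).
Proof.
move=> [f' f_rec fE] [g' g_rec gE]; exists (fun n => code_pair (f' n) (g' n)).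
  exact: recursive_code_pair.
by move=> x; rewrite fE gE.
Qed.

Lemma computable_fst (E S T : countType) (f : E -> S * T) :
  computable f -> computable (fun x => (f x).1).
Proof.
move=> [f' f_rec fE]; exists (fun n => code_head (f' n)).
  exact: (recursive_comp1 recursive_code_head f_rec).
move=> x; rewrite fE; case: (f x) => a b; rewrite pickle_pair.
exact: (code_headE _ [:: pickle b]).
Qed.

Lemma computable_snd (E S T : countType) (f : E -> S * T) :
  computable f -> computable (fun x => (f x).2).
Proof.
move=> [f' f_rec fE]; exists (fun n => code_head (code_tail (f' n))).
  exact: (recursive_comp1 recursive_code_head
    (recursive_comp1 recursive_code_tail f_rec)).
move=> x; rewrite fE; case: (f x) => a b; rewrite pickle_pair.
by rewrite (code_tailE _ [:: pickle b]) (code_headE _ [::]).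
Qed.

Lemma computable_cons (E T : countType) (f : E -> T) (s : E -> seq T) :
  computable f -> computable s -> computable (fun x => f x :: s x).
Proof.
move=> [f' f_rec fE] [s' s_rec sE]; exists (fun n => code_cons (f' n) (s' n)).
  exact: (recursive_comp2 recursive_code_cons f_rec s_rec).
by move=> x; rewrite fE sE.
Qed.

Lemma computable_if (E T : countType) (b : E -> bool) (f g : E -> T) :
  computable b -> computable f -> computable g ->
  computable (fun x => if b x then f x else g x).
Proof.
move=> [b' b_rec bE] [f' f_rec fE] [g' g_rec gE].
exists (fun n => if_zero (b' n) (g' n) (f' n)); first exact: recursive_if.
by move=> x; rewrite bE fE gE; case: (b x).
Qed.

Lemma computable_succ (E : countType) (f : E -> nat) :
  computable f -> computable (fun x => (f x).+1).
Proof.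
move=> [f' f_rec fE]; exists (fun n => (f' n).+1).
  exact: (recursive_comp1 recursive_succ f_rec).
by move=> x; rewrite fE.
Qed.

Lemma computable_half (E : countType) (f : E -> nat) :
  computable f -> computable (fun x => (f x)./2).
Proof.
by apply: computable_comp; exists half; first exact: recursive_half.
Qed.

Lemma computable_odd (E : countType) (f : E -> nat) :
  computable f -> computable (fun x => odd (f x)).
Proof.
by apply: computable_comp; exists (fun n => odd n); first exact: recursive_odd.
Qed.

Lemma computable_double (E : countType) (f : E -> nat) :
  computable f -> computable (fun x => (f x).*2).
Proof.
by apply: computable_comp; exists double; first exact: recursive_double.
Qed.

Lemma computable_pickle (E T : countType) (f : E -> T) :
  computable f -> computable (fun x => pickle (f x)).
Proof. by []. Qed.

Ltac computable_vars := repeat first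
  [ exact: computable_id | apply: computable_fst | apply: computable_snd
  | apply: computable_pair ].

Lemma computable_nat_rect (E T : countType) (n : E -> nat) (z : E -> T)
    (h : E -> nat -> T -> T) :
  computable n -> computable z ->
  computable (fun p : E * (nat * T) => h p.1 p.2.1 p.2.2) ->
  computable (fun x => nat_rect (fun=> T) (z x) (h x) (n x)).
Proof.
move=> [n' n_rec nE] [z' z_rec zE] [h' h_rec hE].
pose r k c := nat_rect (fun=> nat) (z' c)
  (fun k r => h' (code_pair c (code_pair k r))) k.
have r_rec : recursive2 r.
  apply: (recursive_prim2 (h := fun k r c => h' (code_pair c (code_pair k r))))
    => //.
  apply: (recursive_comp1 h_rec).
  apply: recursive_code_pair; first exact: (rec_proj (@Ordinal 3 2 isT)).
  by apply: recursive_code_pair;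
    [exact: recursive_thead | exact: (rec_proj (@Ordinal 3 1 isT))].
exists (fun c => r (n' c) c).
  exact: (recursive_comp2 r_rec n_rec (recursive_thead 0)).
move=> x; rewrite nE pickle_nat; elim: (n x) => [|k IHk] /=; first exact: zE.
by rewrite -/(r k _) IHk; exact: (hE (x, (k, _))).
Qed.

Lemma computable_iter (E T : countType) (n : E -> nat) (z : E -> T)
  (h : E -> T -> T) :
  computable n -> computable z -> computable (fun p : E * T => h p.1 p.2) ->
  computable (fun x => iter (n x) (h x) (z x)).
Proof.
move=> n_comp z_comp h_comp.
apply: (computable_ext (f := fun x => nat_rect _ (z x) (fun _ => h x) (n x))) =>
  [x|].
  by elim: (n x) => //= k ->.
apply: computable_nat_rect => //.
apply: (computable_comp (f := fun p : E * (nat * T) => (p.1, p.2.2)) h_comp).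
by computable_vars.
Qed.

Lemma computable_case (E S T : countType) (s : E -> seq S) (z : E -> T)
    (h : E -> S -> seq S -> T) :
  computable s -> computable z ->
  computable (fun p : E * (S * seq S) => h p.1 p.2.1 p.2.2) ->
  computable (fun x => if s x is a :: l then h x a l else z x).
Proof.
move=> [s' s_rec sE] [z' z_rec zE] [h' h_rec hE].
exists (fun c => if_zero (s' c) (z' c)
  (h' (code_pair c (code_pair (code_head (s' c)) (code_tail (s' c)))))).
  apply: recursive_if => //; apply: (recursive_comp1 h_rec).
  apply: recursive_code_pair; first exact: recursive_thead.
  by apply: recursive_code_pair;
    [exact: recursive_comp1 recursive_code_head s_rec
    |exact: recursive_comp1 recursive_code_tail s_rec].
move=> x; rewrite sE; case: (s x) => [|a l]; first exact: zE.
rewrite pickle_cons code_headE code_tailE -[RHS](hE (x, (a, l))).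
by rewrite {1}/code_cons; case: expn (expn_gt0 2 (pickle a)).
Qed.

(** A fold from the left runs a loop on the pair of the value and the rest of
    the list; the code of the list bounds the number of rounds. *)
Lemma computable_foldl (E S T : countType) (h : E -> T -> S -> T) (z : E -> T)
    (s : E -> seq S) :
  computable (fun p : E * (T * S) => h p.1 p.2.1 p.2.2) ->
  computable z -> computable s ->
  computable (fun x => foldl (h x) (z x) (s x)).
Proof.
move=> h_comp z_comp s_comp.
pose step x (p : T * seq S) := if p.2 is a :: l then (h x p.1 a, l) else p.
have stepE x k y l : size l <= k -> (iter k (step x) (y, l)).1 = foldl (h x) y
  l.
  elim: k y l => [|k IHk] y [|a l] //; last by rewrite iterSr; exact: IHk.
  by move=> _; rewrite iterSr; exact: (IHk _ [::]).
apply: (computable_ext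
  (f := fun x => (iter (pickle (s x)) (step x) (z x, s x)).1)) => [x|].
  apply: stepE; elim: (s x) => //= a l IHl; rewrite pickle_cons /code_cons.
  apply: leq_ltn_trans IHl _;
    rewrite (@leq_trans (pickle l).*2.+1) ?leq_pmull ?expn_gt0 //.
  by rewrite ltnS -addnn leq_addr.
apply/computable_fst/computable_iter => //; first exact: computable_pair.
apply: computable_case.
- by computable_vars.
- by computable_vars.
apply: computable_pair; last by computable_vars.
apply: (computable_comp (f := fun p : E * (T * seq S) * (S * seq S) =>
  (p.1.1, (p.1.2.1, p.2.1))) h_comp).
by computable_vars.
Qed.

Lemma computable_rev (E T : countType) (s : E -> seq T) :
  computable s -> computable (fun x => rev (s x)).
Proof.
move=> s_comp; apply: (computable_ext
  (f := fun x => foldl (fun l a => a :: l) [::] (s x))) => [x|].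
  by elim/last_ind: (s x) => //= l a IHl;
    rewrite -cats1 foldl_cat IHl cats1 rev_rcons.
apply: computable_foldl => //; last exact: computable_const.
by apply: computable_cons; computable_vars.
Qed.

Lemma computable_foldr (E S T : countType) (h : E -> S -> T -> T) (z : E -> T)
    (s : E -> seq S) :
  computable (fun p : E * (S * T) => h p.1 p.2.1 p.2.2) ->
  computable z -> computable s ->
  computable (fun x => foldr (h x) (z x) (s x)).
Proof.
move=> h_comp z_comp s_comp; apply: (computable_ext
  (f := fun x => foldl (fun y a => h x a y) (z x) (rev (s x)))) => [x|].
  by rewrite foldl_rev.
apply: computable_foldl => //.
  apply: (computable_comp (f := fun p : E * (T * S) => (p.1, (p.2.2, p.2.1)))
    h_comp).
  by computable_vars.
exact: computable_rev.
Qed.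

Lemma computable_cat (E T : countType) (s t : E -> seq T) :
  computable s -> computable t -> computable (fun x => s x ++ t x).
Proof.
move=> s_comp t_comp.
apply: (computable_ext (f := fun x => foldr cons (t x) (s x))) => [x|].
  by elim: (s x) => //= a l ->.
apply: computable_foldr => //; by apply: computable_cons; computable_vars.
Qed.

Lemma computable_map (E S T : countType) (f : E -> S -> T) (s : E -> seq S) :
  computable (fun p : E * S => f p.1 p.2) -> computable s ->
  computable (fun x => [seq f x a | a <- s x]).
Proof.
move=> f_comp s_comp; apply: (computable_ext
  (f := fun x => foldr (fun a l => f x a :: l) [::] (s x))) => [x|].
  by elim: (s x) => //= a l ->.
apply: computable_foldr => //; last exact: computable_const.
apply: computable_cons; last by computable_vars.
apply: (computable_comp (f := fun p : E * (S * seq T) => (p.1, p.2.1)) f_comp).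
by computable_vars.
Qed.

Lemma computable_flatten (E T : countType) (s : E -> seq (seq T)) :
  computable s -> computable (fun x => flatten (s x)).
Proof.
move=> s_comp; apply: computable_foldr => //; last exact: computable_const.
by apply: computable_cat; computable_vars.
Qed.

Lemma computable_filter (E S : countType) (b : E -> S -> bool) (s : E -> seq S)
  :
  computable (fun p : E * S => b p.1 p.2) -> computable s ->
  computable (fun x => [seq a <- s x | b x a]).
Proof.
move=> b_comp s_comp; apply: (computable_ext
  (f := fun x => foldr (fun a l => if b x a then a :: l else l) [::] (s x))) =>
    [x|].
  by elim: (s x) => //= a l ->.
apply: computable_foldr => //; last exact: computable_const.
apply: computable_if; last 1 first.
- by computable_vars.
- apply: (computable_comp (f := fun p : E * (S * seq S) => (p.1, p.2.1))
  b_comp).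
  by computable_vars.
by apply: computable_cons; computable_vars.
Qed.

Lemma computable_all (E S : countType) (b : E -> S -> bool) (s : E -> seq S) :
  computable (fun p : E * S => b p.1 p.2) -> computable s ->
  computable (fun x => all (b x) (s x)).
Proof.
move=> b_comp s_comp; apply: (computable_ext
  (f := fun x => foldr (fun a c => if b x a then c else false) true (s x))) =>
    [x|].
  by elim: (s x) => //= a l ->.
apply: computable_foldr => //; last exact: computable_const.
apply: computable_if; last exact: computable_const.
  apply: (computable_comp (f := fun p : E * (S * bool) => (p.1, p.2.1)) b_comp).
  by computable_vars.
by computable_vars.
Qed.

Lemma computable_has (E S : countType) (b : E -> S -> bool) (s : E -> seq S) :
  computable (fun p : E * S => b p.1 p.2) -> computable s ->
  computable (fun x => has (b x) (s x)).
Proof.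
move=> b_comp s_comp; apply: (computable_ext
  (f := fun x => foldr (fun a c => if b x a then true else c) false (s x))) =>
    [x|].
  by elim: (s x) => //= a l ->.
apply: computable_foldr => //; last exact: computable_const.
apply: computable_if; first 1 last.
- exact: computable_const.
- by computable_vars.
apply: (computable_comp (f := fun p : E * (S * bool) => (p.1, p.2.1)) b_comp).
by computable_vars.
Qed.

Lemma computable_size (E T : countType) (s : E -> seq T) :
  computable s -> computable (fun x => size (s x)).
Proof.
move=> s_comp; apply: (computable_ext
  (f := fun x => foldr (fun _ n => n.+1) 0 (s x))) => [x|].
  by elim: (s x) => //= a l ->.
apply: computable_foldr => //; last exact: computable_const.
by apply: computable_succ; computable_vars.
Qed.

Lemma computable_iota (E : countType) (n : E -> nat) :
  computable n -> computable (fun x => iota 0 (n x)).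
Proof.
move=> n_comp; apply: (computable_ext
  (f := fun x => rev (nat_rect _ [::] (fun k l => k :: l) (n x)))) => [x|].
  elim: (n x) => // k /(canRL revK) e; rewrite /= rev_cons e revK.
  by rewrite -[RHS]/(iota 0 k.+1) -[k.+1 in RHS]addn1 iotaD add0n cats1.
apply/computable_rev/computable_nat_rect => //; first exact: computable_const.
by apply: computable_cons; computable_vars.
Qed.

Lemma computable_nth (E T : countType) (x0 : T) (s : E -> seq T) (n : E -> nat)
  :
  computable s -> computable n -> computable (fun x => nth x0 (s x) (n x)).
Proof.
move=> s_comp n_comp; apply: (computable_ext (f := fun x =>
  if iter (n x) behead (s x) is a :: _ then a else x0)) => [x|].
  elim: (n x) (s x) => [|k IHk] [|a l] //; last by rewrite iterSr IHk.
  by rewrite iterSr IHk !nth_nil.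
apply: computable_case; last 1 first.
- by computable_vars.
- apply: (computable_iter (h := fun _ => behead)) => //.
  apply: (computable_ext
    (f := fun p : E * seq T => if p.2 is a :: l then l else [::])) => [x|].
    by case: x.2.
  apply: computable_case; [by computable_vars|exact: computable_const|].
  by computable_vars.
- exact: computable_const.
Qed.

(** A function that is constant beyond a bound is looked up in a finite table,
    no matter how the entries of the table were found. *)
Lemma computable_table (E T : countType) (f : nat -> T) k y (n : E -> nat) :
  (forall i, k <= i -> f i = y) ->
  computable n -> computable (fun x => f (n x)).
Proof.
move=> f_const n_comp; apply: (computable_ext
  (f := fun x => nth y (mkseq f k) (n x))) => [x|].
  have [lt_nk|le_kn] := ltnP (n x) k; first by rewrite nth_mkseq.
  by rewrite nth_default ?size_mkseq // f_const.
by apply: computable_nth => //; exact: computable_const.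
Qed.

(** Non-constructive choices made for each of finitely many inputs stay
    computable: their results form a table. *)
Lemma computable_finfun (E : countType) (S : finType) (T : countType)
  (h : S -> T) (f : E -> S) :
  computable f -> computable (fun x => h (f x)).
Proof.
move=> f_comp; case: (pickP (@predT S)) => [a0 _|noS]; last first.
  exists (fun=> 0); first exact: recursive_const.
  by move=> x; case/idP: (noS (f x)).
pose k := (\max_(a : S) pickle a).+1.
pose g n := if n < k then oapp h (h a0) (unpickle n) else h a0.
apply: (computable_ext (f := fun x => g (pickle (f x)))) => [x|].
  by rewrite /g pickleK ltnS leq_bigmax.
apply: (computable_table (k := k) (y := h a0)); last exact: computable_pickle.
by move=> i; rewrite /g leqNgt => /negPf ->.
Qed.

Lemma computable_finfun2 (E : countType) (S1 S2 : finType) (T : countType)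
  (h : S1 -> S2 -> T)
    (f : E -> S1) (g : E -> S2) :
  computable f -> computable g -> computable (fun x => h (f x) (g x)).
Proof.
move=> f_comp g_comp.
apply: (computable_finfun (fun p => h p.1 p.2) (f := fun x => (f x, g x))).
exact: computable_pair.
Qed.

Lemma computable_neg (E : countType) (b : E -> bool) : computable b ->
  computable (fun x => ~~ b x).
Proof. exact: computable_finfun. Qed.

Lemma computable_and (E : countType) (b c : E -> bool) :
  computable b -> computable c -> computable (fun x => b x && c x).
Proof. exact: computable_finfun2. Qed.

Lemma computable_imply (E : countType) (b c : E -> bool) :
  computable b -> computable c -> computable (fun x => b x ==> c x).
Proof. exact: computable_finfun2. Qed.

Lemma computable_leq (E : countType) (f g : E -> nat) :
  computable f -> computable g -> computable (fun x => f x <= g x).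
Proof.
move=> f_comp g_comp; apply: (computable_ext (f := fun x =>
  nat_rect (fun=> bool) true (fun _ _ => false) (iter (g x) predn (f x)))) =>
    [x|].
  by rewrite iter_predn -subn_eq0; case: (f x - g x).
apply: computable_nat_rect; [|exact: computable_const|exact: computable_const].
apply: (computable_iter (h := fun _ => predn)) => //.
apply: (computable_ext (f := fun p : E * nat =>
  nat_rect (fun=> nat) 0 (fun k _ => k) p.2)) => [[x []]|] //.
by apply: computable_nat_rect; [|exact: computable_const|]; computable_vars.
Qed.

Lemma computable_eq (E T : countType) (f g : E -> T) :
  computable f -> computable g -> computable (fun x => f x == g x).
Proof.
move=> f_comp g_comp; apply: (computable_ext (f := fun x =>
  (pickle (f x) <= pickle (g x)) && (pickle (g x) <= pickle (f x)))) => [x|].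
  by rewrite -eqn_leq (inj_eq (@pickle_inj T)).
by apply: computable_and; apply: computable_leq; exact: computable_pickle.
Qed.

Lemma computable_mem (E T : countType) (f : E -> T) (s : E -> seq T) :
  computable f -> computable s -> computable (fun x => f x \in s x).
Proof.
move=> f_comp s_comp;
  apply: (computable_ext (f := fun x => has (pred1 (f x)) (s x))) => [x|].
  by rewrite has_pred1.
apply: (computable_has (b := fun x => pred1 (f x))) => //=.
apply: computable_eq; first by computable_vars.
by apply: (computable_comp f_comp); computable_vars.
Qed.

Lemma computable_undup (E T : countType) (s : E -> seq T) :
  computable s -> computable (fun x => undup (s x)).
Proof.
move=> s_comp; apply: (computable_ext (f := fun x =>
  foldr (fun a l => if a \in l then l else a :: l) [::] (s x))) => [x|].
  elim: (s x) => //= a l ->; by rewrite mem_undup.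
apply: computable_foldr => //; last exact: computable_const.
apply: computable_if; [|by computable_vars|].
  by apply: computable_mem; computable_vars.
by apply: computable_cons; computable_vars.
Qed.

(** The rules are selected by the head symbol, as unification up to conversion
    would confuse operations that are all folds. *)
Ltac computability := cbv beta; lazymatch goal with
  | |- computable (fun x => x) => exact: computable_id
  | |- computable (fun _ => ?c) => exact: computable_const
  | |- computable fst => apply: computable_fst; exact: computable_id
  | |- computable snd => apply: computable_snd; exact: computable_id
  | |- computable (fun x => (@?f x).1) => apply: computable_fst; computability
  | |- computable (fun x => (@?f x).2) => apply: computable_snd; computability
  | |- computable (fun x => (@?f x, @?g x)) =>
      apply: computable_pair; computability
  | |- computable (fun x => @?f x :: @?g x) =>
      apply: computable_cons; computability
  | |- computable (fun x => @?f x ++ @?g x) =>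
      apply: computable_cat; computability
  | |- computable (fun x => flatten (@?f x)) =>
      apply: computable_flatten; computability
  | |- computable (fun x => size (@?f x)) =>
      apply: computable_size; computability
  | |- computable (fun x => undup (@?f x)) =>
      apply: computable_undup; computability
  | |- computable (fun x => iota 0 (@?f x)) =>
      apply: computable_iota; computability
  | |- computable (fun x => map (@?f x) (@?g x)) =>
      apply: (computable_map (f := f)); computability
  | |- computable (fun x => all (@?f x) (@?g x)) =>
      apply: (computable_all (b := f)); computability
  | |- computable (fun x => has (@?f x) (@?g x)) =>
      apply: (computable_has (b := f)); computability
  | |- computable (fun x => seq.filter (@?f x) (@?g x)) =>
      apply: (computable_filter (b := f)); computability
  | |- computable (fun x => iter (@?n x) (@?h x) (@?z x)) =>
      apply: (computable_iter (h := h)); computability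
  | |- computable (fun x => foldr (@?h x) (@?z x) (@?s x)) =>
      apply: (computable_foldr (h := h)); computability
  | |- computable (fun x => in_mem (@?f x) (mem (@?g x))) =>
      apply: (computable_mem (f := f) (s := g)); computability
  | |- computable (fun x => ~~ @?f x) => apply: computable_neg; computability
  | |- computable (fun x => @?f x && @?g x) =>
      apply: computable_and; computability
  | |- computable (fun x => @?f x ==> @?g x) =>
      apply: computable_imply; computability
  | |- computable (fun x => @?f x == @?g x) =>
      apply: computable_eq; computability
  | |- computable (fun x => (@?f x)./2) =>
      apply: computable_half; computability
  | |- computable (fun x => (@?f x).*2) =>
      apply: computable_double; computability
  | |- computable (fun x => odd (@?f x)) => apply: computable_odd; computability
  | |- computable (fun x => (@?f x).+1) =>
      apply: computable_succ; computability
  | H : computable ?h |- computable ?h => exact: H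
  | H : computable ?h |- computable (fun x => ?h (@?f x)) =>
      apply: (computable_comp H); computability
  | |- _ => idtac
  end.

Lemma computable_unary (S : countType) (h : S -> nat) : computable h ->
  exists f : 1.-tuple nat -> nat, recursive f /\ forall x,
    f [tuple pickle x] = h x.
Proof.
by move=> [g g_rec gE]; exists (fun v => g (thead v)).
Qed.

Lemma computable_binary (S T : countType) (h : S * T -> nat) : computable h ->
  exists f : 2.-tuple nat -> nat,
    recursive f /\ forall x y, f [tuple pickle x; pickle y] = h (x, y).
Proof.
move=> [g g_rec gE].
exists (fun v => g (code_pair (thead v) (tnth v (@Ordinal 2 1 isT)))); split.
  apply: (recursive_comp1 g_rec); apply: recursive_code_pair.
    exact: recursive_thead.
  exact: (rec_proj (@Ordinal 2 1 isT)).
by move=> x y; exact: (gE (x, y)).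
Qed.

Local Open Scope classical_set_scope.
Local Open Scope group_scope.

(** * Generated subgroups *)

Section Generated.

Context {G : groupType}.
Implicit Types (H K B : set G).

Lemma generated_subgroup B : subgroup (generated B).
Proof.
split=> [K [[]] // | x y Bx By K KP | x Bx K KP].
  by case: (KP) => -[_ KM _] _; apply: KM; [exact: Bx | exact: By].
by case: (KP) => -[_ _ KV] _; apply: KV; exact: Bx.
Qed.

Lemma sub_generated B : B `<=` generated B.
Proof. exact: sub_gen_smallest. Qed.

Lemma generated_min B K : subgroup K -> B `<=` K -> generated B `<=` K.
Proof. exact: smallest_sub. Qed.

Lemma setmulA H K L : setmul (setmul H K) L = setmul H (setmul K L).
Proof.
apply/seteqP; split.
  move=> _ [_ [x Hx [y Ky <-]] [z Lz <-]].
  by exists x => //; exists (y * z); [exists y => //; exists z | rewrite mulgA].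
move=> _ [x Hx [_ [y Ky [z Lz <-]] <-]].
by exists (x * y); [exists x => //; exists y | exists z => //; rewrite mulgA].
Qed.

Lemma subgroupX H x n : subgroup H -> H x -> H (x ^+ n).
Proof.
by move=> [H1 HM _] Hx; elim: n => // n IHn; rewrite expgS; exact: HM.
Qed.

Lemma word_prod_cat (s t : seq (G * bool)) : word_prod (s ++ t) = word_prod s *
  word_prod t.
Proof. by elim: s => [|x s IHs] /=; rewrite ?mul1g // IHs mulgA. Qed.

Lemma subgroup_word_prod H B s :
  subgroup H -> B `<=` H -> word_on B s -> H (word_prod s).
Proof.
move=> [H1 HM HV] sBH; elim: s => //= -[x b] s IHs Bs; apply: HM.
  have Hx : H x by apply/sBH/(Bs (x, b)); rewrite mem_head.
  by case: b {Bs} => //=; exact: HV.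
by apply: IHs => y ys; apply: Bs; rewrite inE ys orbT.
Qed.

Lemma generatedP B x :
  generated B x <-> exists2 s, word_on B s & word_prod s = x.
Proof.
split=> [|[s Bs <-]]; last first.
  by apply: subgroup_word_prod Bs;
    [exact: generated_subgroup|exact: sub_generated].
apply: (generated_min
  (K := [set x | exists2 s, word_on B s & word_prod s = x])).
  split; first by exists [::].
    move=> _ _ [s Bs <-] [t Bt <-]; exists (s ++ t); last exact: word_prod_cat.
    by move=> y; rewrite mem_cat => /orP[/Bs|/Bt].
  move=> _ [s Bs <-]; exists (inv_word s).
    move=> y; rewrite /inv_word mem_rev => /mapP[z zs ->]; exact: (Bs z).
  elim: s {Bs} => [|[y b] s IHs]; first by rewrite /= invg1.
  rewrite /inv_word /= rev_cons -cats1 word_prod_cat -/(inv_word s) IHs /= mulg1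
    invMg.
  by case: b => /=; rewrite ?invgK.
by move=> y By; exists [:: (y, false)]; rewrite /= ?mulg1 // => z;
  rewrite inE => /eqP->.
Qed.

End Generated.

(** * Abelian images of a free group *)

Section FreeGroupWords.

Context {A : choiceType}.
Local Notation F := (freeGroup A).
Implicit Types (x : A * bool) (w : seq (A * bool)) (u v : F).

Definition letter x : F := @FreeGroup A [:: x] isT.

Definition ev w : F := foldr (fun x u => letter x * u) 1 w.

Lemma word_letterM x u : word (letter x * u) = cons_red x (word u).
Proof. by []. Qed.

Lemma ev_word u : ev (word u) = u.
Proof.
case: u => w rw; apply: val_inj => /=; elim: w rw => //= x w IHw xw.
rewrite IHw; last exact: path_sorted xw.
by case: w xw {IHw} => //= y w /andP[/negPf ->].
Qed.

Lemma ev_cat w1 w2 : ev (w1 ++ w2) = ev w1 * ev w2.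
Proof. by elim: w1 => [|x w IHw] /=; rewrite ?mul1g // IHw mulgA. Qed.

Lemma letterV x : letter (inv_letter x) = (letter x)^-1.
Proof. by apply: val_inj. Qed.

Lemma letterN a b : letter (a, ~~ b) = (letter (a, b))^-1.
Proof. exact: (letterV (a, b)). Qed.

Lemma letter_inv_letterM x u : letter x * (letter (inv_letter x) * u) = u.
Proof. by rewrite letterV mulVKg. Qed.

Lemma free_ind (P : F -> Prop) :
  P 1 -> (forall x u, P u -> P (letter x * u)) -> forall u, P u.
Proof. by move=> P1 PM u; rewrite -(ev_word u); elim: (word u) => //= x w;
  apply: PM. Qed.

(** The image of a word under the homomorphism to an abelian group that is given
    by the images of the letters. *)
Definition weight (U : zmodType) (c : A -> U) w : U :=
  (\sum_(x <- w) (if x.2 then - c x.1 else c x.1))%R.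

Section Weight.

Variables (U : zmodType) (c : A -> U).
Local Open Scope ring_scope.

Lemma weight_cons x w : weight c (x :: w) = (if x.2 then - c x.1 else c x.1) +
  weight c w.
Proof. exact: big_cons. Qed.

Lemma weight_cons_red x w : weight c (cons_red x w) = weight c (x :: w).
Proof.
case: w => //= y w; case: eqP => // ->; rewrite !weight_cons /=.
by case: (x.2) => /=; rewrite addrA ?addrN ?addNr add0r.
Qed.

Lemma weight_ev w : weight c (ev w) = weight c w.
Proof.
elim: w => // x w IHw.
by rewrite -[ev (x :: w)]/(letter x * ev w)%g word_letterM weight_cons_red
  !weight_cons IHw.
Qed.

Lemma weight1 : weight c (1%g : F) = 0.
Proof. exact: big_nil. Qed.

Lemma weightM u v : weight c (u * v)%g = weight c u + weight c v.
Proof. by rewrite -{1}(ev_word u) -{1}(ev_word v) -ev_cat weight_ev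
  [LHS]big_cat. Qed.

Lemma weightV u : weight c (u^-1)%g = - weight c u.
Proof. by apply/eqP; rewrite -addr_eq0 -weightM mulVg weight1. Qed.

Lemma weightX u n : weight c (u ^+ n)%g = weight c u *+ n.
Proof. by elim: n => [|n IHn]; rewrite ?weight1 // expgS weightM IHn mulrS. Qed.

End Weight.

End FreeGroupWords.

(** * The verbal subgroup generated by commutators and powers *)

Section AbelianCongruence.

Context {G : groupType}.
Variable M : set G.
Hypothesis M_subgroup : subgroup M.
Hypothesis M_comm : forall x y, M [~ x, y].

(** Normality is automatic, since x^y = x [x, y]. *)
Lemma conj_comm_closed x y : M x -> M (x ^ y).
Proof.
by case: M_subgroup => _ MM _ Mx; rewrite -(mulKVg x (x ^ y)) -commgEl;
  apply: MM.
Qed.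

Definition cong x y := M (x^-1 * y).

Lemma cong_refl x : cong x x.
Proof. by rewrite /cong mulVg; case: M_subgroup. Qed.

Lemma cong_sym x y : cong x y -> cong y x.
Proof. by case: M_subgroup => _ _ MV /MV; rewrite /cong invMg invgK. Qed.

Lemma cong_trans y x z : cong x y -> cong y z -> cong x z.
Proof.
case: M_subgroup => _ MM _ xy yz.
by rewrite /cong -(mulKVg y z) mulgA; apply: MM.
Qed.

Lemma congM x x' y y' : cong x x' -> cong y y' -> cong (x * y) (x' * y').
Proof.
case: M_subgroup => _ MM _ xx' yy'; rewrite /cong.
have -> : (x * y)^-1 * (x' * y') = (x^-1 * x') ^ y * (y^-1 * y').
  by rewrite conjgE invMg !mulgA mulgK.
by apply: MM => //; exact: conj_comm_closed.
Qed.

Lemma congC x y : cong (x * y) (y * x).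
Proof. by rewrite /cong invMg -!mulgA -conjgE -commgEl; apply: M_comm. Qed.

Lemma congACA x y z t : cong (x * y * (z * t)) (x * z * (y * t)).
Proof.
rewrite -!mulgA; apply: congM (cong_refl x) _; rewrite !mulgA.
exact: congM (congC _ _) (cong_refl t).
Qed.

Lemma cong1P x : cong 1 x <-> M x.
Proof. by rewrite /cong invg1 mul1g. Qed.

End AbelianCongruence.

Section Verbal.

Context {G : groupType}.
Variable m : nat.

Lemma derived_subgroup : subgroup (@derived G).
Proof. exact: generated_subgroup. Qed.

Lemma derived_comm (x y : G) : derived [~ x, y].
Proof. by apply: sub_generated; exists x, y. Qed.

Lemma powers_exp (x : G) : powers m (x ^+ m).
Proof. by apply: sub_generated; exists x. Qed.

(** The verbal subgroup of the laws [x, y] = 1 and x^m = 1. *)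
Definition verbal : set G := setmul derived (powers m).

Lemma verbal_subgroup : subgroup verbal.
Proof.
have [D1 DM DV] := derived_subgroup.
have [P1 PM PV] := generated_subgroup [set x ^+ m | x in [set: G]].
have DJ := conj_comm_closed derived_subgroup derived_comm.
split; first by exists 1 => //; exists 1 => //; rewrite mulg1.
  move=> _ _ [d Dd [p Pp <-]] [d' Dd' [p' Pp' <-]].
  exists (d * d' ^ p^-1); first by apply: DM => //; exact: DJ.
  by exists (p * p'); [exact: PM | rewrite conjgE invgK !mulgA mulgVK].
move=> _ [d Dd [p Pp <-]]; exists (d^-1 ^ p); first by apply: DJ; apply: DV.
by exists p^-1; [exact: PV | rewrite invMg conjgE -!mulgA mulgV mulg1].
Qed.

Lemma verbal_comm (x y : G) : verbal [~ x, y].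
Proof.
exists [~ x, y]; first exact: derived_comm.
by exists 1; [case: (generated_subgroup [set x ^+ m | x in [set: G]]) |
  rewrite mulg1].
Qed.

Lemma verbal_exp (x : G) : verbal (x ^+ m).
Proof.
exists 1; first by case: derived_subgroup.
by exists (x ^+ m); [exact: powers_exp | rewrite mul1g].
Qed.

Lemma verbal_min K :
  subgroup K -> (forall x y, K [~ x, y]) -> (forall x, K (x ^+ m)) ->
    verbal `<=` K.
Proof.
move=> K_sub K_comm K_exp _ [d Dd [p Pp <-]]; case: (K_sub) => _ KM _;
  apply: KM.
  by apply: (generated_min K_sub _ Dd) => _ [x [y ->]].
by apply: (generated_min K_sub _ Pp) => _ [x _ <-].
Qed.

End Verbal.

(** * Exponent sums modulo m *)

Section ExponentSums.

Context {A : choiceType}.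
Variable m' : nat.
Local Notation m := m'.+1.
Local Notation F := (freeGroup A).
Implicit Types (a : A) (u v : F).

Definition indicator a (b : A) : 'I_m := if b == a then Zp1 else 0%R.

Definition exp_sum a (w : seq (A * bool)) : 'I_m := weight (indicator a) w.

Lemma exp_sum_notin a (w : seq (A * bool)) :
  a \notin [seq x.1 | x <- w] -> exp_sum a w = 0%R.
Proof.
move=> a_w; rewrite /exp_sum /weight big1_seq // => -[b d] /= bw.
rewrite /indicator (_ : b == a = false) ?oppr0 ?if_same //.
by apply: contraNF a_w => /eqP <-; exact: (map_f _ bw).
Qed.

Lemma ord_mulrn_exp (k : 'I_m) : (k *+ m = 0)%R.
Proof. by rewrite Zp_mulrn; apply: val_inj; rewrite /= modnMl. Qed.

Lemma kernel_subgroup (U : zmodType) (c : A -> U) : subgroup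
  [set u : F | weight c u = 0%R].
Proof.
split=> [|u v /= ku kv|u /= ku]; first exact: weight1.
  by rewrite /= weightM ku kv addr0.
by rewrite /= weightV ku oppr0.
Qed.

Lemma verbal_exp_sum a u : verbal m u -> exp_sum a u = 0%R.
Proof.
apply: (@verbal_min _ m [set u : F | exp_sum a u = 0%R]) => [|x y|x].
- exact: kernel_subgroup.
- rewrite /mkset commgEl conjgE /exp_sum !weightM !weightV.
  by rewrite addrA -opprD addNr.
- by rewrite /mkset /exp_sum weightX ord_mulrn_exp.
Qed.

(** Modulo commutators and m-th powers every element is the ordered product of
    the letters raised to its exponent sums. *)
Definition normal_form (s : seq A) (k : A -> 'I_m) : F :=
  foldr (fun a u => letter (a, false) ^+ k a * u) 1 s.

Local Notation congv := (cong (verbal m)).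
Let vs := @verbal_subgroup F m.
Let vc := @verbal_comm F m.

Lemma cong_exp_mod u n : congv (u ^+ (n %% m)) (u ^+ n).
Proof.
rewrite {2}(divn_eq n m) expgnDr mulnC expgnA -[X in cong _ X]mul1g.
apply: (congM vs vc); last exact: cong_refl.
by apply/cong1P; apply: (subgroupX _ vs); exact: verbal_exp.
Qed.

Lemma cong_expD u (i j : 'I_m) : congv (u ^+ i * u ^+ j) (u ^+ (i + j)%R).
Proof. by rewrite -expgnDr; apply: (cong_sym vs); exact: cong_exp_mod. Qed.

Lemma normal_formD s k l :
  congv (normal_form s k * normal_form s l)
    (normal_form s (fun a => k a + l a)%R).
Proof.
elim: s => [|a s IHs]; first by rewrite /= mulg1; apply: cong_refl.
apply: (cong_trans vs (congACA vs vc _ _ _ _)); apply: (congM vs vc) => //.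
exact: cong_expD.
Qed.

Lemma normal_form0 s k : (forall a, a \in s -> k a = 0%R) ->
  normal_form s k = 1.
Proof.
elim: s => //= a s IHs k0; rewrite k0 ?mem_head // mul1g IHs // => b bs.
by apply: k0; rewrite inE bs orbT.
Qed.

Lemma normal_form_indicator s a :
  uniq s -> a \in s -> congv (normal_form s (fun b => indicator b a))
    (letter (a, false)).
Proof.
elim: s => //= b s IHs /andP[b_s s_uniq]; rewrite inE /indicator /=.
have [eq_ab _ | neq_ab a_s] := eqVneq a b; last by rewrite mul1g; apply: IHs.
rewrite normal_form0 => [|c cs]; last first.
  by case: eqP => // eq_ac; move: b_s; rewrite -eq_ab eq_ac cs.
by rewrite mulg1 eq_ab; exact: (cong_exp_mod (letter (b, false)) 1).
Qed.

Lemma normal_form_indicatorN s a : uniq s -> a \in s ->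
  congv (normal_form s (fun b => - indicator b a)%R) (letter (a, true)).
Proof.
move=> s_uniq a_s; have nfa := normal_form_indicator s_uniq a_s.
rewrite -[letter (a, true)]mul1g -[X in cong _ X _](mulgK (letter (a, false))).
rewrite -letterV; apply: (congM vs vc); last exact: cong_refl.
apply: (cong_trans vs (congM vs vc (cong_refl vs _) (cong_sym vs nfa))).
apply: (cong_trans vs (normal_formD _ _ _)).
by rewrite normal_form0 => [|b _]; [exact: cong_refl | rewrite addNr].
Qed.

Lemma normal_form_ev s w : uniq s -> {subset [seq x.1 | x <- w] <= s} ->
  congv (normal_form s (fun a => exp_sum a w)) (ev w).
Proof.
move=> s_uniq; elim: w => [_ | [a b] w IHw sws].
  by rewrite normal_form0 => [|a _]; [exact: cong_refl | exact: weight1].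
pose k c := (if b then - indicator c a else indicator c a)%R.
have -> : (fun c => exp_sum c ((a, b) :: w)) = (fun c => k c + exp_sum c w)%R.
  by apply: funext => c; exact: weight_cons.
apply: (cong_trans vs (cong_sym vs (normal_formD _ _ _))); apply: (congM vs vc).
  rewrite /k; case: b {k sws} (sws a (mem_head _ _)) => a_s.
    exact: normal_form_indicatorN.
  exact: normal_form_indicator.
by apply: IHw => c cw; apply: sws; rewrite inE cw orbT.
Qed.

(** An element whose exponent sums vanish is congruent to an empty product. *)
Lemma verbalP u : verbal m u <-> forall a, exp_sum a u = 0%R.
Proof.
split=> [Vu a | u0]; first exact: verbal_exp_sum.
apply/cong1P; rewrite -(ev_word u).
rewrite -(@normal_form0 (undup [seq x.1 | x <- word u]) (fun a => exp_sum a u))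
  //.
by apply: normal_form_ev => [|a]; rewrite ?undup_uniq // mem_undup.
Qed.

(** * The closure in the topology of abelian groups of exponent m *)

Lemma setmul_verbalP (H : set F) u :
  setmul H (verbal m) u <-> exists2 h, H h & forall a,
    exp_sum a h = exp_sum a u.
Proof.
split=> [[h Hh [v /verbalP v0 <-]] | [h Hh eq_hu]].
  by exists h => // a; rewrite /exp_sum weightM [X in (_ + X)%R]v0 addr0.
exists h => //; exists (h^-1 * u); last by rewrite mulVKg.
by apply/verbalP => a;
  rewrite /exp_sum weightM weightV [X in (- X + _)%R]eq_hu addNr.
Qed.

(** The map to the group of row vectors given by the exponent sums of finitely
    many letters. *)
Definition exp_row (s : seq A) u : 'rV['I_m]_(size s) :=
  (\row_i exp_sum (tnth (in_tuple s) i) u)%R.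

Lemma exp_rowM s u v : exp_row s (u * v) = exp_row s u * exp_row s v.
Proof. by apply/rowP => i; rewrite !mxE /exp_sum weightM. Qed.

HB.instance Definition _ (s : seq A) :=
  isMultiplicative.Build F 'rV['I_m]_(size s) (exp_row s) (exp_rowM s).

Lemma row_ab_class n : ab_class m ('rV['I_m]_n : finGroupType).
Proof.
apply/ab_classP; split=> [x y|x]; first exact: addrC.
have -> : x ^+ m = (x *+ m)%R by elim: (m) => // k IHk; rewrite expgS mulrS IHk.
by apply/rowP => i; rewrite mulmxnE mxE ord_mulrn_exp.
Qed.

End ExponentSums.

Section Closure.

Variables (V : pseudovariety) (G : groupType).
Implicit Types (H : set G) (u h : G).

(** Every basic neighbourhood of an element is cut out by finitely many
    homomorphisms to groups of the pseudovariety. *)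
Lemma Cl_indistinguishable H u h : H h ->
  (forall (gT : finGroupType) (f : {multiplicative G -> gT}),
     V gT -> f h = f u) ->
  Cl V H u.
Proof.
move=> Hh eq_hu B; rewrite nbhsE => -[_ [[D' sD' <-] [C D'C Cu]] sB].
have [D sD eqC] := sD' _ D'C.
suff Ch : C h by exists h; split=> //; apply: sB; exists C.
rewrite -eqC => E /= DE.
have := sD _ DE; rewrite inE => -[gT [VgT [f [S eqE]]]].
have: E u by move: Cu; rewrite -eqC => /(_ _ DE).
by rewrite eqE /= (eq_hu _ f VgT).
Qed.

(** The fibre of f over f u is a neighbourhood of u. *)
Lemma Cl_separated H u (gT : finGroupType) (f : {multiplicative G -> gT}) :
  V gT -> Cl V H u -> exists2 h, H h & f h = f u.
Proof.
move=> VgT Clu; suff /Clu[h [Hh /= fh]] : nbhs (u : pro V G) (f @^-1` [set f u])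
  by exists h.
rewrite nbhsE; exists (f @^-1` [set f u]) => //; split=> //.
exists [set f @^-1` [set f u]]; last by rewrite bigcup_set1.
move=> _ ->; exists [fset (f @^-1` [set f u])%classic]%fset.
  move=> E /fset1P ->; rewrite inE; exists gT; split=> //.
  by exists f, [set f u].
apply/seteqP; split=> [x /= fx | x fx E /=]; last by move=> /fset1P ->.
by apply: (fx (f @^-1` [set f u])); apply/fset1P.
Qed.

End Closure.

Section ClosureAb.

Context {A : choiceType}.
Variable m' : nat.
Local Notation m := m'.+1.
Local Notation F := (freeGroup A).

(** The class of groups satisfies the defining laws of the verbal subgroup. *)
Lemma hom_verbal (gT : finGroupType) (f : {multiplicative F -> gT}) v :
  ab_class m gT -> verbal m v -> f v = 1.
Proof.
move=> /ab_classP[gTC gTm] Vv.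
have f1 : f 1 = 1 by apply: (mulgI (f 1)); rewrite -gmulfM !mulg1.
have fV x : f x^-1 = (f x)^-1 by apply: (mulgI (f x)); rewrite -gmulfM !mulgV.
apply: (@verbal_min _ m [set v : F | f v = 1] _ _ _ _ Vv) => [|x y|x].
- split=> [|x y fx fy|x fx]; first exact: f1.
    by rewrite /mkset gmulfM [f x]fx [f y]fy mulg1.
  by rewrite /mkset fV [f x]fx invg1.
- by rewrite /mkset commgEl conjgE !gmulfM !fV (gTC (f x)) mulKg mulVg.
- by rewrite /mkset -(gTm (f x)); elim: (m) => // n IHn;
  rewrite !expgS gmulfM IHn.
Qed.

Lemma Cl_Ab (H : set F) : fin_gen H -> Cl (Ab m) H = setmul H (verbal m).
Proof.
move=> [X ->]; apply/seteqP; split=> u; last first.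
  move=> [h Hh [v Vv <-]]; apply: (Cl_indistinguishable Hh) => gT f abT.
  by rewrite gmulfM (hom_verbal f abT Vv) mulg1.
(* Letters that occur neither in u nor in the generators have exponent sum 0 on
   both sides, so finitely many exponent sums separate u from H. *)
pose s := [seq x.1 | x <- word u] ++ letters X.
move=> /(@Cl_separated (Ab m) _ _ _ _ (@exp_row A m' s) (row_ab_class _ _))[h Hh
  eq_hu].
apply/setmul_verbalP; exists h => // a.
have [a_s | a_s] := boolP (a \in s).
  have /rowP/(_ (Ordinal (etrans (index_mem a s) a_s))) := eq_hu.
  by rewrite !mxE (tnth_nth a) /= nth_index.
move: a_s; rewrite mem_cat negb_or => /andP[a_u a_X];
  rewrite [RHS]exp_sum_notin //.
apply: (generated_min (K := [set h | exp_sum m' a (word h) = 0%R])) Hh.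
  exact: kernel_subgroup.
move=> x xX; apply: exp_sum_notin; apply: contra a_X => /mapP[y yx ->].
by apply: map_f; apply/flattenP; exists (word x) => //; apply: map_f.
Qed.

Lemma Cl_AbP (H : set F) u : fin_gen H ->
  Cl (Ab m) H u <-> exists2 h, H h & forall a, exp_sum m' a h = exp_sum m' a u.
Proof. by move=> /Cl_Ab->; exact: setmul_verbalP. Qed.

End ClosureAb.

(** * Codes of words *)

Section WordCodes.

Context {A : choiceType}.
Variable e : A -> nat.
Local Notation F := (freeGroup A).

Definition letter_code (x : A * bool) : nat := ((e x.1).*2 + x.2)%N.

Lemma half_letter_code x : (letter_code x)./2 = e x.1.
Proof. by rewrite /letter_code addnC half_bit_double. Qed.

Lemma odd_letter_code x : odd (letter_code x) = x.2.
Proof. by rewrite /letter_code oddD odd_double oddb. Qed.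

Definition word_codes (w : seq (A * bool)) : seq nat := map letter_code w.

Lemma pickle_word_codes w : pickle (word_codes w) = code_word e w.
Proof. by rewrite /pickle /= /pickle_seq map_id. Qed.

Lemma code_word_cons x w :
  code_word e (x :: w) = code_cons (letter_code x) (code_word e w).
Proof. by []. Qed.

Lemma letter_code_inj : injective e -> injective letter_code.
Proof.
move=> e_inj [a b] [a' b'] eq_code.
have := congr1 odd eq_code; rewrite !odd_letter_code /= => ->.
by have := congr1 half eq_code; rewrite !half_letter_code /= => /e_inj->.
Qed.

Lemma code_word_inj : injective e -> injective (code_word e).
Proof.
by move=> e_inj w w' /(can_inj CodeSeq.codeK)/(inj_map (letter_code_inj e_inj)).
Qed.

Lemma pickle_elts_codes (X : seq F) :
  pickle [seq word_codes (word w) | w <- X] = code_elts e X.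
Proof.
rewrite /pickle /= /pickle_seq /code_elts -map_comp; congr CodeSeq.code.
by apply: eq_map => w; exact: pickle_word_codes.
Qed.

End WordCodes.

(** * Schreier bases *)

Section Schreier.

Context {A : choiceType}.
Local Notation F := (freeGroup A).
Variables (e : A -> nat) (C : set F).
Hypotheses (e_inj : injective e) (C_subgroup : subgroup C).
Implicit Types (x : A * bool) (w : seq (A * bool)) (g h u v : F).

Lemma leq_code_cons k c d : (code_cons k c <= code_cons k d)%N = (c <= d)%N.
Proof. by rewrite leq_pmul2l ?expn_gt0 // ltnS leq_double. Qed.

Definition same_coset g h : Prop := C (g^-1 * h).

Lemma same_coset_refl g : same_coset g g.
Proof. by rewrite /same_coset mulVg; case: C_subgroup. Qed.

Lemma same_coset_sym g h : same_coset g h -> same_coset h g.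
Proof. by case: C_subgroup => _ _ CV /CV; rewrite invMg invgK. Qed.

Lemma same_coset_trans h g u : same_coset g h -> same_coset h u ->
  same_coset g u.
Proof.
case: C_subgroup => _ CM _ gh hu; have := CM _ _ gh hu.
by rewrite mulgA mulgK.
Qed.

Lemma same_cosetM u g h : same_coset g h -> same_coset (u * g) (u * h).
Proof. by rewrite /same_coset invMg -mulgA mulKg. Qed.

(** The representative of a left coset is its word with the least code. As the
    code of x :: w increases with the code of w, representatives are closed
    under passing to suffixes. *)
Lemma rep_exists g : exists w, same_coset g (ev w) /\
  forall w', same_coset g (ev w') -> (code_word e w <= code_word e w')%N.
Proof.
have [|n /asboolP[w [<- gw]] min_n] := @ex_minnP
    (fun n => `[< exists w, code_word e w = n /\ same_coset g (ev w) >]).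
  exists (code_word e (word g)); apply/asboolP; exists (word g); split=> //.
  by rewrite ev_word; exact: same_coset_refl.
exists w; split=> // w' gw'; apply: min_n; apply/asboolP; by exists w'.
Qed.

Definition rep g : seq (A * bool) := sval (cid (rep_exists g)).

Lemma rep_coset g : same_coset g (ev (rep g)).
Proof. by case: (svalP (cid (rep_exists g))). Qed.

Lemma rep_min g w : same_coset g (ev w) ->
  (code_word e (rep g) <= code_word e w)%N.
Proof. by case: (svalP (cid (rep_exists g))) => _ /(_ w). Qed.

Lemma eq_rep g h : same_coset g h -> rep g = rep h.
Proof.
move=> gh; apply: (code_word_inj e_inj); apply/eqP; rewrite eqn_leq !rep_min //.
  exact: same_coset_trans (same_coset_sym gh) (rep_coset g).
exact: same_coset_trans gh (rep_coset h).
Qed.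

Lemma rep1 : rep 1 = [::].
Proof.
apply: (code_word_inj e_inj); apply/eqP; rewrite -leqn0;
  apply: (@rep_min _ [::]).
exact: same_coset_refl.
Qed.

(** Replacing a suffix by its coset representative would lower the code. *)
Lemma rep_suffix x w : rep (ev (x :: w)) = x :: w -> rep (ev w) = w.
Proof.
move=> rep_xw; apply: (code_word_inj e_inj); apply/eqP; rewrite eqn_leq.
rewrite (rep_min (same_coset_refl _)) /=.
rewrite -(leq_code_cons (letter_code e x)) -!code_word_cons -rep_xw.
by apply: rep_min; apply/same_cosetM/rep_coset.
Qed.

Definition repr_elt g : F := ev (rep g).

Definition schreier_gen (a : A) g : F :=
  (repr_elt (letter (a, false) * g))^-1 * (letter (a, false) * repr_elt g).

(** Trivial generators come from the letters that lead from a representative to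
    a representative. *)
Definition schreier_basis : set F :=
  [set b | b != 1 /\ exists a g, b = schreier_gen a g].

(** Reading the letter x from the coset of g contributes one generator, the
    inverse of one, or nothing. *)
Definition letter_output x g : seq (F * bool) :=
  let b := schreier_gen x.1 (if x.2 then letter x * g else g) in
  if b == 1 then [::] else [:: (b, x.2)].

(** Letters are read from the right, along the left cosets of the suffixes. *)
Fixpoint rewriting g w : seq (F * bool) :=
  if w is x :: w' then letter_output x (ev w' * g) ++ rewriting g w' else [::].

Lemma eq_schreier_gen a g h :
  same_coset g h -> schreier_gen a g = schreier_gen a h.
Proof.
by move=> gh; rewrite /schreier_gen /repr_elt (eq_rep gh)
  (eq_rep (same_cosetM _ gh)).
Qed.

Lemma eq_letter_output x g h :
  same_coset g h -> letter_output x g = letter_output x h.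
Proof.
move=> gh; rewrite /letter_output
  (@eq_schreier_gen _ _ (if x.2 then letter x * h else h)) //.
by case: (x.2) => //; exact: same_cosetM.
Qed.

Lemma eq_rewriting g h w : same_coset g h -> rewriting g w = rewriting h w.
Proof.
move=> gh; elim: w => //= x w ->; congr (_ ++ _).
by apply: eq_letter_output; exact: same_cosetM.
Qed.

Lemma word_on_rewriting g w : word_on schreier_basis (rewriting g w).
Proof.
elim: w => //= x w IHw b; rewrite mem_cat => /orP[|/IHw //].
rewrite /letter_output; case: eqP => // /eqP neq1; rewrite inE => /eqP -> /=.
by split=> //; exists x.1; eexists.
Qed.

Lemma word_prod_letter_output x g : word_prod (letter_output x g) =
  (repr_elt (letter x * g))^-1 * (letter x * repr_elt g).
Proof.
transitivity (let b := schreier_gen x.1 (if x.2 then letter x * g else g) in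
              if x.2 then b^-1 else b).
  rewrite /letter_output; case: eqP => [-> | _] /=; last by rewrite mulg1.
  by case: (x.2); rewrite ?invg1.
case: x => a [] //=; rewrite /schreier_gen -[(a, false)]/(inv_letter (a, true)).
rewrite -{1 2}(inv_letterK (a, true)) letter_inv_letterM.
by rewrite letterV !invMg !invgK mulgA.
Qed.

(** The product telescopes along the suffixes of the word. *)
Lemma word_prod_rewriting g w :
  word_prod (rewriting g w) = (repr_elt (ev w * g))^-1 * (ev w * repr_elt g).
Proof.
elim: w => [|x w IHw] /=; first by rewrite !mul1g mulVg.
by rewrite word_prod_cat IHw word_prod_letter_output -!mulgA mulVKg.
Qed.

Lemma rewritingP u : C u -> word_prod (rewriting 1 (word u)) = u.
Proof.
move=> Cu; rewrite word_prod_rewriting ev_word mulg1 /repr_elt.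
have -> : rep u = rep 1.
  by apply: eq_rep; apply: same_coset_sym; rewrite /same_coset invg1 mul1g.
by rewrite rep1 /= invg1 mul1g mulg1.
Qed.

Lemma schreier_gen_in a g : C (schreier_gen a g).
Proof.
case: C_subgroup => _ CM CV.
have := CM _ _ (CV _ (rep_coset (letter (a, false) * g))) (rep_coset g).
by rewrite /schreier_gen !invMg !invgK -!mulgA mulVKg.
Qed.

Lemma generated_schreier_basis : generated schreier_basis = C.
Proof.
apply/seteqP; split=> u.
  by apply: generated_min => // b [_ [a [g ->]]]; exact: schreier_gen_in.
move=> Cu; apply/generatedP; exists (rewriting 1 (word u));
  last exact: rewritingP.
exact: word_on_rewriting.
Qed.

(** Rewriting induces a homomorphism from C to the free group on the Schreier
    generators that sends each generator to itself. *)
Definition rewriting_elt g u : freeGroup F := ev (rewriting g (word u)).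

Lemma ev_letter_outputV x g :
  ev (letter_output x (letter (inv_letter x) * g)) * ev
    (letter_output (inv_letter x) g) = 1.
Proof.
rewrite /letter_output; case: x => a [] /=.
  rewrite (letter_inv_letterM (a, true)); case: eqP => _;
    first by rewrite mulg1.
  by rewrite /= !mulg1 (letterN _ true) mulgV.
case: eqP => _; first by rewrite mulg1.
by rewrite /= !mulg1 (letterN _ true) mulVg.
Qed.

Lemma rewriting_eltE x g u :
  rewriting_elt g (letter x * u) = ev (letter_output x (u * g)) * rewriting_elt
    g u.
Proof.
rewrite -[in letter_output x (u * g)](ev_word u) /rewriting_elt word_letterM.
case: (word u) => [|y w] /=; first by rewrite cats0 mul1g mulg1.
case: eqP => [-> | _] /=; last by rewrite !ev_cat.
have := ev_letter_outputV x (ev w * g); rewrite (mulgA (letter _)) => outV.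
by rewrite ev_cat (mulgA (ev _) (ev _)) outV mul1g.
Qed.

Lemma rewriting_eltM g u v :
  rewriting_elt g (u * v) = rewriting_elt (v * g) u * rewriting_elt g v.
Proof.
elim/(@free_ind A): u => [|x u IHu]; first by rewrite !mul1g.
by rewrite -mulgA !rewriting_eltE IHu !mulgA.
Qed.

Lemma rewriting_elt_ev g w : rewriting_elt g (ev w) = ev (rewriting g w).
Proof. by elim: w => //= x w IHw; rewrite rewriting_eltE IHw ev_cat. Qed.

(** All suffixes of a representative are representatives, so reading it outputs
    only trivial generators. *)
Lemma rewriting_rep g : rewriting 1 (rep g) = [::].
Proof.
have: rep (ev (rep g)) = rep g by apply/esym/eq_rep/rep_coset.
elim: (rep g) => //= x w IHw rep_xw; have rep_w := rep_suffix rep_xw.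
rewrite IHw // cats0 mulg1.
have: word_prod (letter_output x (ev w)) = 1.
  by rewrite word_prod_letter_output /repr_elt rep_w [rep _]rep_xw mulVg.
rewrite /letter_output; case: eqP => // neq1 /=; rewrite mulg1.
by case: (x.2) neq1 => neq1 /eqP; rewrite ?invg_eq1 => /eqP.
Qed.

(** A generator is read as a representative, one letter, and the inverse of a
    representative; only the letter produces output. *)
Lemma rewriting_elt_basis b :
  schreier_basis b -> rewriting_elt 1 b = letter (b, false).
Proof.
move=> [neq1 [a [g eq_b]]]; have rep0 h : rewriting_elt 1 (repr_elt h) = 1.
  by rewrite rewriting_elt_ev rewriting_rep.
rewrite eq_b {1}/schreier_gen rewriting_eltM rewriting_eltE rep0 !mulg1.
set h := letter (a, false) * g.
have -> : rewriting_elt (letter (a, false) * repr_elt g) (repr_elt h)^-1 = 1.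
  rewrite /rewriting_elt (@eq_rewriting _ (repr_elt h)) -/(rewriting_elt _ _).
    by have := rewriting_eltM 1 (repr_elt h)^-1 (repr_elt h);
      rewrite mulVg rep0 !mulg1.
  apply: (same_coset_trans _ (rep_coset h)); apply: same_cosetM.
  by apply: same_coset_sym; exact: rep_coset.
rewrite mul1g /letter_output /= (@eq_schreier_gen a _ g) -?eq_b ?(negPf neq1)
  /= ?mulg1 //.
by apply: same_coset_sym; exact: rep_coset.
Qed.

Lemma rewriting_elt_word_prod s :
  word_on schreier_basis s -> rewriting_elt 1 (word_prod s) = ev s.
Proof.
elim: s => //= -[b c] s IHs Bs;
  have Bb : schreier_basis b by apply: (Bs (b, c)); rewrite mem_head.
have Bs' : word_on schreier_basis s by move=> y ys; apply: Bs;
  rewrite inE ys orbT.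
have CB : schreier_basis `<=` C by rewrite -generated_schreier_basis;
  exact: sub_generated.
have in_C v u : C v -> rewriting_elt (v * 1) u = rewriting_elt 1 u.
  move=> Cv; rewrite mulg1 /rewriting_elt (@eq_rewriting _ 1) //.
  by apply: same_coset_sym; rewrite /same_coset invg1 mul1g.
rewrite rewriting_eltM in_C ?IHs //; last exact: subgroup_word_prod CB Bs'.
congr (_ * _); case: c {Bs} => /=; last exact: rewriting_elt_basis.
have := rewriting_eltM 1 b^-1 b; rewrite mulVg in_C; last exact: CB.
rewrite (rewriting_elt_basis Bb) => eq1; apply: etrans (esym (letterN b false)).
by apply: (mulIg (letter (b, false))); rewrite mulVg -eq1.
Qed.

(** A reduced word on the generators with trivial product is the rewriting of 1,
    hence empty. *)
Lemma schreier_free_basis : free_basis schreier_basis C.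
Proof.
split=> [|s s_red Bs s1]; first exact: generated_schreier_basis.
have := rewriting_elt_word_prod Bs; rewrite s1 => /esym s0.
by rewrite -[s]/(word (FreeGroup s_red)) -(ev_word (FreeGroup s_red)) /= s0.
Qed.

Lemma finite_schreier_basis (K : finType) (phi : F -> K) :
  finite_set [set: A] -> (forall g h, phi g = phi h -> same_coset g h) ->
  finite_set schreier_basis.
Proof.
move=> A_fin phiP; pose lift k := xget 1 [set g | phi g = k].
apply: (@sub_finite_set _ _
  ((fun p : A * K => schreier_gen p.1 (lift p.2)) @` setT)).
  move=> b [_ [a [g ->]]]; exists (a, phi g) => //=; apply: eq_schreier_gen.
  by apply: phiP; apply: (@xgetPex _ 1 [set h | phi h = phi g]); exists g.
apply: finite_image; rewrite -setXTT; exact: finite_setX.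
Qed.

End Schreier.

(** * Density and the prime divisors of m *)

Section Density.

Context {G : groupType}.
Implicit Types (H : set G) (x y u : G).

Local Notation congd := (cong (@derived G)).
Let ds := @derived_subgroup G.
Let dc := @derived_comm G.

Lemma cong_derivedMX x y n : congd ((x * y) ^+ n) (x ^+ n * y ^+ n).
Proof.
elim: n => [|n IHn]; first by rewrite mulg1; apply: cong_refl.
rewrite !expgS; apply: (cong_trans ds (congM ds dc (cong_refl ds _) IHn)).
exact: congACA.
Qed.

Lemma cong_derivedX x y n : congd x y -> congd (x ^+ n) (y ^+ n).
Proof.
move=> cxy; elim: n => [|n IHn]; first exact: cong_refl.
by rewrite !expgS; apply: (congM ds dc).
Qed.

Lemma powersP m u : powers m u -> exists x, congd u (x ^+ m).
Proof.
apply: (@generated_min _ _ [set u | exists x, congd u (x ^+ m)]); last first.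
  by move=> _ [x _ <-]; exists x; apply: cong_refl.
split=> [|v w [x cvx] [y cwy] | v [x cvx]].
- by exists 1; rewrite expg1n; apply: cong_refl.
- exists (x * y); apply: (cong_trans ds (congM ds dc cvx cwy)).
  exact: (cong_sym ds (cong_derivedMX _ _ _)).
exists x^-1; rewrite expVgn.
have := congM ds dc (cong_refl ds v^-1)
  (congM ds dc (cong_sym ds cvx) (cong_refl ds (x ^- m))).
by rewrite mulgV mulg1 mulKg.
Qed.

(** Modulo commutators a product of d-th powers is a d-th power, so one power is
    enough to say that every element lies in H times the verbal subgroup. *)
Definition dense_mod (d : nat) H : Prop :=
  forall u, exists2 h, H h & exists x, congd u (h * x ^+ d).

Lemma dense_modP d H : subgroup H -> setmul H (verbal d) = setT <->
  dense_mod d H.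
Proof.
move=> [H1 HM HV]; split=> [HVT u | Hd].
  have : setmul H (verbal d) u by rewrite HVT.
  move=> [h Hh [_ [c Dc [p Pp <-]] <-]]; exists h => //.
  have [x cpx] := powersP Pp; exists x; apply: (congM ds dc (cong_refl ds _)).
  rewrite -[X in cong _ _ X]mul1g; apply: (congM ds dc) => //.
  by apply: (cong_sym ds); apply/cong1P.
apply/seteqP; split=> // u _; have [h Hh [x cux]] := Hd u.
exists h => //; exists (h^-1 * u); last by rewrite mulVKg.
have [_ VM VV] := verbal_subgroup (G := G) d.
have -> : h^-1 * u = x ^+ d * (u^-1 * (h * x ^+ d))^-1.
  by rewrite !invMg invgK -!mulgA mulVKg.
apply: VM; first exact: verbal_exp.
apply: VV; exists (u^-1 * (h * x ^+ d)); first exact: cux.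
by exists 1; [case: (generated_subgroup [set x ^+ d | x in [set: G]]) |
  rewrite mulg1].
Qed.

(** If u = h x^c and x = h' y^d modulo commutators, then u = h h'^c y^(cd). *)
Lemma dense_modM c d H :
  subgroup H -> dense_mod c H -> dense_mod d H -> dense_mod (c * d) H.
Proof.
move=> H_sub Hc Hd u; have [h Hh [x cux]] := Hc u;
  have [h' Hh' [y cxy]] := Hd x.
exists (h * h' ^+ c); first by case: (H_sub) => _ HM _; apply: HM => //;
  exact: subgroupX.
exists y; apply: (cong_trans ds cux); rewrite -mulgA mulnC expgnA.
apply: (congM ds dc (cong_refl ds _));
  apply: (cong_trans ds (cong_derivedX _ cxy)).
exact: cong_derivedMX.
Qed.

Lemma dense_mod_primes d H : subgroup H -> (0 < d)%N ->
  (forall p, prime p -> (p %| d)%N -> dense_mod p H) -> dense_mod d H.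
Proof.
move=> H_sub; have [n] := ubnP d; elim: n d => // n IHn d lt_dn d_gt0 Hp.
have [d_gt1 | d_le1] := ltnP 1 d; last first.
  have -> : d = 1%N by apply/eqP; rewrite eqn_leq d_le1.
  move=> u; exists 1; first by case: H_sub.
  by exists u; rewrite mul1g; apply: cong_refl.
rewrite -(divnK (pdiv_dvd d)); apply: dense_modM => //; last first.
  by apply: Hp; [exact: pdiv_prime | exact: pdiv_dvd].
apply: IHn => [||p p_prime p_d].
- by rewrite -ltnS (leq_trans _ lt_dn) // ltnS ltn_Pdiv // prime_gt1 //
  pdiv_prime.
- by rewrite divn_gt0 ?pdiv_gt0 // dvdn_leq // pdiv_dvd.
by apply: Hp => //; apply: dvdn_trans p_d _; apply/dvdn_div/pdiv_dvd.
Qed.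

Lemma verbal_dvd c d : (c %| d)%N -> @verbal G d `<=` verbal c.
Proof.
move=> /dvdnP[k ->]; apply: verbal_min => [|x y|x];
  first exact: verbal_subgroup.
  exact: verbal_comm.
by rewrite expgnA; exact: verbal_exp.
Qed.

Lemma setmul_verbal_primes d H : subgroup H -> (0 < d)%N ->
  setmul H (verbal d) = setT <->
  forall p, prime p -> (p %| d)%N -> setmul H (verbal p) = setT.
Proof.
move=> H_sub d_gt0; split=> [HT p _ p_d | HT].
  apply/seteqP; split=> // u _; have : setmul H (verbal d) u by rewrite HT.
  by move=> [h Hh [v Vv <-]]; exists h => //; exists v => //;
    exact: verbal_dvd Vv.
apply/dense_modP => //; apply: dense_mod_primes => // p p_prime p_d.
by apply/dense_modP => //; exact: HT.
Qed.

End Density.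

(** * Finite generation of the closure *)

Section FiniteGeneration.

Context {A : choiceType}.
Variable m' : nat.
Local Notation m := m'.+1.
Local Notation F := (freeGroup A).
Implicit Types (H : set F) (u v : F).

Lemma setmul_verbal_subgroup H : subgroup H -> subgroup (setmul H (verbal m)).
Proof.
move=> [H1 HM HV]; split=> [|u v|u]; rewrite ?setmul_verbalP.
- by exists 1.
- move=> [h Hh eq_u] [k Hk eq_v]; exists (h * k) => [|a]; first exact: HM.
  by rewrite /exp_sum !weightM [X in (X + _)%R]eq_u [X in (_ + X)%R]eq_v.
- move=> [h Hh eq_u]; exists h^-1 => [|a]; first exact: HV.
  by rewrite /exp_sum !weightV [X in (- X)%R]eq_u.
Qed.

Lemma verbal_sub_setmul H : subgroup H -> verbal m `<=` setmul H (verbal m).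
Proof. by move=> [H1 _ _] v Vv; exists 1 => //; exists v => //;
  rewrite mul1g. Qed.

Lemma exp_row_same_coset (C : set F) (s : seq A) :
  verbal m `<=` C -> (forall a, a \in s) ->
  forall u v, exp_row m' s u = exp_row m' s v -> same_coset C u v.
Proof.
move=> VC sA u v eq_uv; apply: VC; apply/verbalP => a.
rewrite /exp_sum weightM weightV -!/(exp_sum m' a _).
have /rowP/(_ (Ordinal (etrans (index_mem a s) (sA a)))) := eq_uv.
by rewrite !mxE (tnth_nth a) /= nth_index // => ->; rewrite addNr.
Qed.

Lemma finite_enumeration : finite_set [set: A] -> exists2 s : seq A,
  uniq s & forall a, a \in s.
Proof.
move=> /finite_seqP[s eq_s]; exists (undup s) => [|a]; first exact: undup_uniq.
by rewrite mem_undup; have : [set: A] a by []; rewrite eq_s.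
Qed.

Lemma finite_verbal_basis (e : A -> nat) (C : set F) (C_sub : subgroup C) :
  injective e -> finite_set [set: A] -> verbal m `<=` C ->
  exists B : seq F, uniq B /\ [set` B] = schreier_basis e C_sub.
Proof.
move=> e_inj A_fin VC; have [s _ sA] := finite_enumeration A_fin.
have /finite_seqP[B eq_B] : finite_set (schreier_basis e C_sub).
  exact: (finite_schreier_basis e_inj C_sub A_fin (exp_row_same_coset VC sA)).
exists (undup B); split; first exact: undup_uniq.
by rewrite eq_B; apply/seteqP; split=> b /=; rewrite mem_undup.
Qed.

(** The power a^m of a letter a outside the generators would have nonzero
    integer exponent sum at a. *)
Lemma verbal_letters (Y : seq F) :
  verbal m `<=` generated [set` Y] -> forall a, a \in letters Y.
Proof.
move=> VY a; apply: contraT => a_Y;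
  pose c b : int := if b == a then 1%R else 0%R.
have Y0 : generated [set` Y] `<=` [set u : F | weight c u = 0%R].
  apply: generated_min => [|y yY]; first exact: kernel_subgroup.
  rewrite /mkset /weight big1_seq // => -[b d] /= bd_y.
  rewrite /c (_ : b == a = false) ?oppr0 ?if_same //.
  apply: contraNF a_Y => /eqP <-; apply/mapP; exists (b, d) => //.
  by apply/flattenP; exists (word y) => //; apply: map_f.
have /VY/Y0 : verbal m (letter (a, false) ^+ m) by apply: verbal_exp.
rewrite /mkset weightX weight_cons [X in (_ + X)%R](big_nil) addr0 /c eqxx =>
  /eqP.
by rewrite Num.Theory.pnatr_eq0.
Qed.

Lemma fin_gen_verbal (C : set F) : subgroup C -> verbal m `<=` C ->
  fin_gen C <-> finite_set [set: A].
Proof.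
move=> C_sub VC; split=> [[Y eq_C] | A_fin]; last first.
  have [s _ sA] := finite_enumeration A_fin.
  have e_inj : injective (index^~ s).
    by move=> a b eq_ab; rewrite -(nth_index a (sA a)) eq_ab nth_index.
  have [B [_ eq_B]] := finite_verbal_basis C_sub e_inj A_fin VC.
  by exists B; rewrite eq_B generated_schreier_basis.
have YA := verbal_letters (Y := Y); rewrite -eq_C in YA.
by apply/finite_seqP; exists (letters Y); apply/seteqP; split=> a //= _;
  apply: YA.
Qed.

End FiniteGeneration.

(** * Bases of closures over a finite alphabet *)

Section FiniteAlphabet.

Context {A : choiceType}.
Variables (m' : nat) (e : A -> nat) (s : seq A).
Local Notation m := m'.+1.
Local Notation F := (freeGroup A).
Hypotheses (e_inj : injective e) (sA : forall a, a \in s).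
Implicit Types (u v g : F) (X : seq F).

Local Notation Q := 'rV['I_m]_(size s).

Let letters_seq := [seq (a, b) | a <- s, b <- [:: false; true]].
Let N := \max_(x <- letters_seq) letter_code e x.

(** Numbers above the codes of all letters are identified, which leaves finitely
    many inputs. *)
Definition bounded_code (k : nat) : 'I_N.+1 := inord (minn k N).

Definition decode_letter (i : nat) : option (A * bool) :=
  ohead [seq x <- letters_seq | letter_code e x == i].

Lemma computable_bounded_code (E : countType) (f : E -> nat) :
  computable f -> computable (fun x => bounded_code (f x)).
Proof.
apply: (computable_table (k := N) (y := inord N)) => i le_Ni.
by rewrite /bounded_code (minn_idPr le_Ni).
Qed.

Lemma decode_letter_code (x : A * bool) : decode_letter
  (bounded_code (letter_code e x)) = Some x.
Proof.
have xs : x \in letters_seq.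
  by case: x => a b; apply: (@allpairs_f A bool); rewrite ?sA //; case: b.
rewrite /bounded_code (minn_idPl _) ?leq_bigmax_seq // inordK; last first.
  by rewrite ltnS; apply: leq_bigmax_seq.
rewrite /decode_letter; case eq_f: [seq _ <- _ | _] => [|y t].
  have : x \in [seq y <- letters_seq | letter_code e y == letter_code e x].
    by rewrite mem_filter eqxx.
  by rewrite eq_f.
have : y \in [seq y <- letters_seq | letter_code e y == letter_code e x].
  by rewrite eq_f mem_head.
by rewrite mem_filter => /andP[/eqP/(letter_code_inj e_inj) -> _].
Qed.

Definition letter_row (i : 'I_N.+1) : Q :=
  if decode_letter i is Some x then exp_row m' s (letter x) else 0%R.

Definition word_row (l : seq nat) : Q :=
  foldr (fun k r => letter_row (bounded_code k) + r)%R 0%R l.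

Lemma word_row_codes w : word_row (word_codes e w) = exp_row m' s (ev w).
Proof.
elim: w => [|x w IHw] /=; first by apply/rowP => i;
  rewrite !mxE /exp_sum weight1.
rewrite IHw /letter_row decode_letter_code; exact: esym (exp_rowM _ _ _ _).
Qed.

Lemma computable_word_row (E : countType) (f : E -> seq nat) :
  computable f -> computable (fun x => word_row (f x)).
Proof.
move=> f_comp; apply: computable_foldr => //; last exact: computable_const.
apply: (computable_finfun2 (fun i r => letter_row i + r)%R);
  last by computable_vars.
by apply: computable_bounded_code; computable_vars.
Qed.

(** The closure of a subgroup depends only on the finite set of exponent sums of
    its generators. *)
Definition gen_rows X : {set Q} := [set:: map (exp_row m' s) X].

Definition code_rows (c : seq (seq nat)) : {set Q} :=
  foldr (fun l S => word_row l |: S)%SET finset.set0 c.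

Lemma code_rows_elts X :
  code_rows [seq word_codes e (word w) | w <- X] = gen_rows X.
Proof.
elim: X => [|u X IHX] /=; first by apply/setP => r; rewrite !inE.
by rewrite IHX word_row_codes ev_word; apply/setP => r; rewrite !inE.
Qed.

Lemma computable_code_rows (E : countType) (f : E -> seq (seq nat)) :
  computable f -> computable (fun x => code_rows (f x)).
Proof.
move=> f_comp; apply: computable_foldr => //; last exact: computable_const.
apply: (computable_finfun2 (fun r (S : {set Q}) => r |: S)%SET);
  last by computable_vars.
by apply: computable_word_row; computable_vars.
Qed.

Definition closure_of X : set F := setmul (generated [set` X]) (verbal m).

Lemma closure_of_subgroup X : subgroup (closure_of X).
Proof. exact: setmul_verbal_subgroup (generated_subgroup _). Qed.

Lemma verbal_sub_closure X : verbal m `<=` closure_of X.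
Proof. exact: verbal_sub_setmul (generated_subgroup _). Qed.

Lemma closure_of_sub X Y :
  (forall u, u \in X -> exists2 v, v \in Y & exp_row m' s u = exp_row m' s v) ->
  closure_of X `<=` closure_of Y.
Proof.
move=> XY _ [h Xh [v Vv <-]]; have [_ YM _] := closure_of_subgroup Y.
apply: (YM); last exact: verbal_sub_closure.
apply: (generated_min (closure_of_subgroup Y) _ Xh) => u /= /XY[w wY eq_uw].
have := exp_row_same_coset (@verbal_sub_closure Y) sA (esym eq_uw).
rewrite /same_coset -{2}(mulKVg w u); apply: YM.
by exists w; [exact: sub_generated | exists 1; rewrite ?mulg1 //;
  case: (verbal_subgroup (G := F) m)].
Qed.

Lemma closure_of_rows X Y : gen_rows X = gen_rows Y ->
  closure_of X = closure_of Y.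
Proof.
move=> /setP eq_XY; apply/seteqP; split; apply: closure_of_sub => u uX.
  have : exp_row m' s u \in gen_rows Y by rewrite -eq_XY inE map_f.
  by rewrite inE => /mapP[v vY ->]; exists v.
have : exp_row m' s u \in gen_rows X by rewrite eq_XY inE map_f.
by rewrite inE => /mapP[v vY ->]; exists v.
Qed.

(** A choice of generators for each of the finitely many sets of rows. *)
Definition some_gens (S : {set Q}) : seq F := xget [::]
  [set X | gen_rows X = S].

Lemma closure_some_gens X : closure_of (some_gens (gen_rows X)) = closure_of X.
Proof.
apply: closure_of_rows.
exact: (@xgetPex _ [::] [set Y | gen_rows Y = gen_rows X] (ex_intro _ X erefl)).
Qed.

Let A_finite : finite_set [set: A].
Proof. by apply/finite_seqP; exists s; apply/seteqP; split=> a //= _;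
  apply: sA. Qed.

Definition rows_subgroup S := closure_of_subgroup (some_gens S).

Definition rows_basis (S : {set Q}) : seq F :=
  sval (cid (finite_verbal_basis (rows_subgroup S) e_inj A_finite
              (@verbal_sub_closure (some_gens S)))).

Lemma rows_basis_uniq S : uniq (rows_basis S).
Proof. by case: (svalP
  (cid (finite_verbal_basis (rows_subgroup S) e_inj A_finite
              (@verbal_sub_closure (some_gens S))))). Qed.

Lemma rows_basisE S : [set` rows_basis S] = schreier_basis e (rows_subgroup S).
Proof. by case: (svalP
  (cid (finite_verbal_basis (rows_subgroup S) e_inj A_finite
              (@verbal_sub_closure (some_gens S))))). Qed.

Lemma rows_basis_free X :
  free_basis [set` rows_basis (gen_rows X)] (closure_of X).
Proof. by rewrite -(closure_some_gens X) rows_basisE;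
  exact: schreier_free_basis. Qed.

(** The generators met on the way only depend on the coset, hence on exponent
    sums, so reading a word takes finitely many states. *)
Definition row_output (S : {set Q}) (i : 'I_N.+1) (r : Q) : seq nat :=
  if decode_letter i is Some x then
    word_codes (code_elt e)
      (letter_output e (rows_subgroup S) x
        (xget 1 [set g | exp_row m' s g = r]))
  else [::].

Definition row_rewriting (S : {set Q}) (l : seq nat) : Q * seq nat :=
  foldr (fun k p => (letter_row (bounded_code k) + p.1,
                     row_output S (bounded_code k) p.1 ++ p.2)%R) (0%R, [::]) l.

Lemma row_rewriting_codes S w : row_rewriting S (word_codes e w) =
  (exp_row m' s (ev w),
    word_codes (code_elt e) (rewriting e (rows_subgroup S) 1 w)).
Proof.
elim: w => [|x w IHw]; first by congr (_, _); apply/rowP => i;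
  rewrite !mxE /exp_sum weight1.
rewrite [LHS]/= -/(word_codes e w) -/(row_rewriting S _) IHw /=; congr (_, _).
  by rewrite /letter_row decode_letter_code; exact: esym (exp_rowM _ _ _ _).
rewrite /row_output decode_letter_code [in RHS]/word_codes map_cat;
  congr (map _ _ ++ _).
apply: (eq_letter_output e_inj); rewrite mulg1.
apply: (exp_row_same_coset (@verbal_sub_closure _) sA).
by apply: (@xgetPex _ 1 [set g | exp_row m' s g = exp_row m' s (ev w)]);
  exists (ev w).
Qed.

Lemma computable_row_rewriting (E : countType) (S : E -> {set Q})
  (f : E -> seq nat) :
  computable S -> computable f ->
    computable (fun x => (row_rewriting (S x) (f x)).2).
Proof.
move=> S_comp f_comp; apply: computable_snd.
apply: (computable_foldr (h := fun x k p => (letter_row (bounded_code k) + p.1,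
                     row_output (S x) (bounded_code k) p.1 ++ p.2)%R)) => //;
                       last exact: computable_const.
have code_comp : computable (fun p : E * (nat * (Q * seq nat)) =>
  bounded_code p.2.1).
  by apply: computable_bounded_code; computable_vars.
apply: computable_pair.
  by apply: (computable_finfun2 (fun i r => letter_row i + r)%R) => //;
    computable_vars.
apply: computable_cat; last by computable_vars.
apply: (computable_finfun2 (fun S (ir : 'I_N.+1 * Q) => row_output S ir.1 ir.2)
  (f := fun p => S p.1) (g := fun p => (bounded_code p.2.1, p.2.2.1))).
  by apply: (computable_comp S_comp); computable_vars.
by apply: computable_pair => //; computable_vars.
Qed.

End FiniteAlphabet.

(** * Membership in the closure *)

(** For n = m these words realize all exponent sums modulo m that occur in the
    subgroup generated by the words of c. *)
Definition bounded_products (T : Type) n (c : seq (seq T)) : seq (seq T) :=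
  foldr (fun l ps =>
    flatten [seq [seq iter j (cat l) p | p <- ps] | j <- iota 0 n])
    [:: [::]] c.

Lemma map_bounded_products (T U : Type) (f : T -> U) n c :
  bounded_products n (map (map f) c) = map (map f) (bounded_products n c).
Proof.
elim: c => //= l c ->; rewrite map_flatten -map_comp; congr flatten.
apply: eq_map => j /=; rewrite -!map_comp; apply: eq_map => p /=.
by elim: j => //= j ->; rewrite map_cat.
Qed.

Lemma bounded_products_cons (T : eqType) n l (c : seq (seq T)) p :
  reflect (exists j q,
    [/\ (j < n)%N, q \in bounded_products n c & p = iter j (cat l) q])
    (p \in bounded_products n (l :: c)).
Proof.
apply: (iffP flattenP) => [[ps /mapP[j]] | [j [q [lt_jn qc ->]]]].
  rewrite mem_iota => /andP[_ lt_jn] -> /mapP[q qc ->]; by exists j, q.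
exists [seq iter j (cat l) q | q <- bounded_products n c]; last exact: map_f.
by apply: map_f; rewrite mem_iota.
Qed.

Section CodedMembership.

Variable m' : nat.
Local Notation m := m'.+1.

Definition add_sign (b : bool) (i : 'I_m) : 'I_m :=
  ((if b then - Zp1 else Zp1) + i)%R.

(** The exponent sum, in a word of letter codes, of the letter named k. *)
Definition code_exp (k : nat) (l : seq nat) : 'I_m :=
  foldr (fun c (r : 'I_m) => if c./2 == k then add_sign (odd c) r else r) ord0
    l.

(** It is enough to compare exponent sums at the letters of the two words: the
    others vanish on both sides. *)
Definition code_member (c : seq (seq nat)) (l : seq nat) : bool :=
  has (fun p => all (fun k => code_exp k p == code_exp k l) (map half (p ++ l)))
    (bounded_products m c).

Lemma computable_code_exp (E : countType) (k : E -> nat) (l : E -> seq nat) :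
  computable k -> computable l -> computable (fun x => code_exp (k x) (l x)).
Proof.
move=> k_comp l_comp; rewrite /code_exp; computability.
apply: computable_if; computability.
by apply: computable_finfun2; computability.
Qed.

Lemma computable_bounded_products (E : countType) n (c : E -> seq (seq nat)) :
  computable c -> computable (fun x => bounded_products n (c x)).
Proof. by move=> c_comp; rewrite /bounded_products; computability. Qed.

Lemma computable_code_member (E : countType) (c : E -> seq (seq nat))
  (l : E -> seq nat) :
  computable c -> computable l -> computable (fun x => code_member (c x) (l x)).
Proof.
move=> c_comp l_comp; rewrite /code_member.
have prods_comp := computable_bounded_products m c_comp.
by computability; apply: computable_code_exp; computability.
Qed.

Context {A : choiceType}.
Local Notation F := (freeGroup A).

Lemma code_exp_codes (e : A -> nat) (a : A) w :
  {in a :: [seq x.1 | x <- w] &, injective e} ->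
  code_exp (e a) (word_codes e w) = exp_sum m' a w.
Proof.
elim: w => [|[b d] w IHw] e_inj; first by rewrite /exp_sum /weight big_nil.
rewrite /exp_sum weight_cons -[X in (_ + X)%R]IHw; last first.
  by apply: sub_in2 e_inj => b'; rewrite !inE => /orP[->|->]; rewrite ?orbT.
rewrite /= half_letter_code odd_letter_code /indicator /=.
rewrite (inj_in_eq e_inj) ?inE ?eqxx ?orbT //.
by case: eqP => //; case: (d); rewrite ?oppr0 add0r.
Qed.

Lemma bounded_products_sound (X : seq F) p :
  p \in bounded_products m (map (@word A) X) -> generated [set` X] (ev p).
Proof.
suff gen (Y : set F) : subgroup Y -> [set` X] `<=` Y ->
    p \in bounded_products m (map (@word A) X) -> Y (ev p).
  by apply: gen; [exact: generated_subgroup | exact: sub_generated].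
move=> [Y1 YM YV]; elim: X p => [|u X IHX] p XY; first by rewrite inE => /eqP->.
move=> /bounded_products_cons[j [q [_ qX ->]]].
have Yu : Y u by apply: XY; rewrite /= mem_head.
have Yq : Y (ev q) by apply: IHX qX => v vX; apply: XY; rewrite /= inE vX orbT.
by elim: j => //= j IHj; rewrite ev_cat ev_word; apply: YM.
Qed.

Lemma exp_sum_iter_cat a (w p : seq (A * bool)) j :
  exp_sum m' a (iter j (cat w) p) = (exp_sum m' a w *+ j + exp_sum m' a p)%R.
Proof.
elim: j => [|j IHj] /=; first by rewrite add0r.
by rewrite /exp_sum /weight big_cat /= -!/(weight _ _) -!/(exp_sum m' a _) IHj
  mulrS addrA.
Qed.

Lemma mulrn_modm (i : 'I_m) j : (i *+ (j %% m) = i *+ j)%R.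
Proof. by rewrite [in RHS](divn_eq j m) mulrnDr mulnC mulrnA ord_mulrn_exp
  mul0rn add0r. Qed.

(** Exponents may be reduced modulo m without changing exponent sums, which
    makes the set of elements matched by bounded products a subgroup. *)
Lemma bounded_products_complete (X : seq F) h : generated [set` X] h ->
  exists2 p, p \in bounded_products m (map (@word A) X) &
    forall a, exp_sum m' a p = exp_sum m' a h.
Proof.
pose K X := [set h : F | exists2 p, p \in bounded_products m (map (@word A) X) &
    forall a, exp_sum m' a p = exp_sum m' a h].
suff [K_sub XK] : subgroup (K X) /\ [set` X] `<=` K X
  by exact: (generated_min K_sub XK).
elim: X {h} => [|u X [[K1 KM KV] XK]].
  split=> //; split=> [|v w /= [p]|v /= [p]]; first by exists [::].
    rewrite inE => /eqP-> p0 [q]; rewrite inE => /eqP-> q0; exists [::] => // a.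
    by rewrite /exp_sum weightM -[X in (X + _)%R]p0 -[X in (_ + X)%R]q0 /exp_sum
      /weight big_nil addr0.
  rewrite inE => /eqP-> p0; exists [::] => // a.
  by rewrite /exp_sum weightV -[X in (- X)%R]p0 /exp_sum /weight big_nil oppr0.
have KS j h : K X h -> K (u :: X) (u ^+ j * h).
  move=> [p pX ph]; exists (iter (j %% m) (cat (word u)) p) => [|a].
    by apply/bounded_products_cons; exists (j %% m)%N, p; rewrite ltn_mod.
  by rewrite exp_sum_iter_cat mulrn_modm ph /exp_sum weightM weightX.
have KE h : K (u :: X) h -> exists j h', K X h' /\
    forall a, exp_sum m' a h = (exp_sum m' a u *+ j + exp_sum m' a h')%R.
  move=> [p /bounded_products_cons[j [q [_ qX ->]]] ph]; exists j, (ev q);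
    split.
    by exists q => // a; rewrite /exp_sum weight_ev.
  by move=> a; rewrite -ph exp_sum_iter_cat /exp_sum weight_ev.
have Keq h (h' : F) : K (u :: X) h ->
  (forall a, exp_sum m' a h = exp_sum m' a h') -> K (u :: X) h'.
  by move=> [p pX ph] eqh; exists p => // a; rewrite ph.
split; last first.
  move=> v /=; rewrite inE => /orP[/eqP-> | /XK Kv]; last by rewrite -[v]mul1g;
    apply: (KS 0%N).
  by have := KS 1%N _ K1; rewrite mulg1.
split=> [|v w /KE[i [v' [Kv' eqv]]] /KE[j [w' [Kw' eqw]]] | v
  /KE[i [v' [Kv' eqv]]]].
- by have := KS 0%N _ K1; rewrite mulg1.
- apply: Keq (KS (i + j)%N _ (KM _ _ Kv' Kw')) _ => a.
  rewrite /exp_sum !weightM weightX mulrnDr [weight _ v](eqv a)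
    [weight _ w](eqw a).
  by rewrite addrACA.
apply: Keq (KS (i * m')%N _ (KV _ Kv')) _ => a.
rewrite /exp_sum weightM weightX !weightV [weight _ v](eqv a) opprD;
  congr (_ - _)%R.
apply/eqP; rewrite mulrnA -addr_eq0 addrC -mulrS; apply/eqP;
  exact: ord_mulrn_exp.
Qed.

Lemma letters_bounded_products n (c : seq (seq (A * bool))) p x :
  p \in bounded_products n c -> x \in p -> x \in flatten c.
Proof.
elim: c p => [|l c IHc] p; first by rewrite inE => /eqP->.
move=> /bounded_products_cons[j [q [_ qc ->]]] /=; rewrite mem_cat.
elim: j => [/(IHc _ qc) -> | j IHj]; first by rewrite orbT.
by rewrite /= mem_cat => /orP[-> | /IHj].
Qed.

Lemma code_memberP (e : A -> nat) (X : seq F) (w : F) :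
  {in letters (w :: X) &, injective e} ->
  code_member [seq word_codes e (word u) | u <- X] (word_codes e w) <->
  Cl (Ab m) (generated [set` X]) w.
Proof.
move=> e_inj; rewrite Cl_AbP; last by exists X.
have -> : [seq word_codes e (word u) | u <- X] = map (map (letter_code e))
  (map (@word A) X).
  by rewrite -map_comp.
rewrite /code_member map_bounded_products.
have expE p a : p \in bounded_products m (map (@word A) X) ->
    a \in [seq x.1 | x <- p ++ word w] ->
    (code_exp (e a) (map (letter_code e) p) == code_exp (e a) (word_codes e w))
      =
    (exp_sum m' a p == exp_sum m' a w).
  move=> pX a_pw; rewrite -/(word_codes e p).
  have pw_sub : {subset [seq x.1 | x <- p ++ word w] <= letters (w :: X)}.
    move=> _ /mapP[x + ->]; rewrite mem_cat => x_pw; apply: map_f;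
      rewrite /= mem_cat.
    by case/orP: x_pw => [/(letters_bounded_products pX) ->|->]; rewrite ?orbT.
  by rewrite !code_exp_codes //; apply: sub_in2 e_inj => b; rewrite inE =>
    /orP[/eqP-> | b_pw]; apply: pw_sub => //;
      rewrite map_cat mem_cat b_pw ?orbT.
split=> [/hasP[_ /mapP[p pX ->] /allP all_pw] |
  [h /bounded_products_complete[p pX ph] hw]].
  exists (ev p) => [|a]; first exact: bounded_products_sound pX.
  rewrite [LHS](weight_ev (indicator m' a) p) -/(exp_sum m' a p).
  have [a_pw | a_pw] := boolP (a \in [seq x.1 | x <- p ++ word w]).
    apply/eqP; rewrite -expE //; apply: all_pw.
    have [x x_pw ->] := mapP a_pw; rewrite -half_letter_code; apply: map_f.
    by rewrite -map_cat; apply: map_f.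
  move: a_pw; rewrite map_cat mem_cat negb_or => /andP[a_p a_w].
  by rewrite !exp_sum_notin.
apply/hasP; exists (map (letter_code e) p); first exact: map_f.
apply/allP => k; rewrite -map_cat -map_comp => /mapP[x x_pw ->] /=.
by rewrite half_letter_code expE ?ph ?hw // map_f.
Qed.

Lemma closure_member_decidable : decidable_membership (@Cl (Ab m) F).
Proof.
have [|f [f_rec fE]] := @computable_binary (seq (seq nat)) (seq nat)
    (fun p => nat_of_bool (code_member p.1 p.2)).
  by apply: computable_finfun; apply: computable_code_member; computability.
exists f; split=> // X w e e_inj.
rewrite -(code_memberP e_inj) -pickle_elts_codes
  -[code_elt e w]pickle_word_codes fE /=.
by case: code_member.
Qed.

(** * Density *)

Definition code_dense (n : nat) (c : seq (seq nat)) : bool :=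
  (size (undup (map half (flatten c))) == n) &&
  all (fun k => code_member c [:: k]) (flatten c).

Lemma computable_code_dense (E : countType) n (c : E -> seq (seq nat)) :
  computable c -> computable (fun x => code_dense n (c x)).
Proof.
move=> c_comp; rewrite /code_dense.
have c1_comp : computable (fun p : E * nat => c p.1).
  by apply: (computable_comp c_comp); computability.
by computability; apply: computable_code_member; computability.
Qed.

Lemma names_codes (e : A -> nat) (X : seq F) :
  map half (flatten [seq word_codes e (word u) | u <- X]) = map e (letters X).
Proof.
rewrite /letters; elim: X => //= u X IHX; rewrite !map_cat IHX; congr (_ ++ _).
by rewrite -!map_comp; apply: eq_map => x /=; rewrite half_letter_code.
Qed.

(** As distinct letters have distinct names, the number of names tells whether
    every letter of the alphabet occurs. *)
Lemma all_letters_occur (e : A -> nat) (s : seq A) (X : seq F) :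
  uniq s -> (forall a, a \in s) -> {in letters X &, injective e} ->
  size (undup (map half (flatten [seq word_codes e (word u) | u <- X]))) == size
    s <->
  forall a, a \in letters X.
Proof.
move=> s_uniq sA e_inj; rewrite names_codes.
have -> : size (undup (map e (letters X))) = size (undup (letters X)).
  rewrite -(size_map e); apply: perm_size; apply: uniq_perm;
    first exact: undup_uniq.
    rewrite map_inj_in_uniq ?undup_uniq // => a b; rewrite !mem_undup;
      exact: e_inj.
  move=> k; rewrite mem_undup.
  by apply/mapP/mapP => -[a aX ->]; exists a; rewrite ?mem_undup // -mem_undup.
split=> [/eqP eq_size a | all_X].
  have [||_ eqX] := uniq_min_size (undup_uniq (letters X)) (s2 := s).
  - by move=> b _.
  - by rewrite eq_size.
  by rewrite -mem_undup eqX.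
by rewrite eqn_leq !uniq_leq_size ?undup_uniq // => a; rewrite ?mem_undup.
Qed.

(** A letter that does not occur in X has exponent sum 0 on the subgroup, but 1
    on itself, and these differ modulo m > 1. *)
Lemma dense_letters (X : seq F) : (0 < m')%N ->
  Vdense (Ab m) (generated [set` X]) -> forall a, a \in letters X.
Proof.
move=> m'_gt0 dense a; apply: contraT => a_X.
have : Cl (Ab m) (generated [set` X]) (letter (a, false)) by rewrite dense.
rewrite Cl_AbP; last by exists X.
move=> [h Xh eqh]; have : exp_sum m' a h = 0%R.
  apply: (generated_min (K := [set h | exp_sum m' a (word h) = 0%R])) Xh.
    exact: kernel_subgroup.
  move=> u uX; apply: exp_sum_notin; apply: contra a_X => /mapP[x xu ->].
  by apply: map_f; apply/flattenP; exists (word u) => //; apply: map_f.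
rewrite eqh /exp_sum weight_cons [X in (_ + X)%R](big_nil) addr0 /indicator
  eqxx.
by move=> /(congr1 val) /=; rewrite modn_small.
Qed.

Lemma code_denseP (e : A -> nat) (s : seq A) (X : seq F) :
  (0 < m')%N -> uniq s -> (forall a, a \in s) ->
    {in letters X &, injective e} ->
  code_dense (size s) [seq word_codes e (word u) | u <- X] <->
  Vdense (Ab m) (generated [set` X]).
Proof.
move=> m_gt1 s_uniq sA e_inj;
  have X_fg : fin_gen (generated [set` X]) by exists X.
have C_sub : subgroup (Cl (Ab m) (generated [set` X])).
  by rewrite Cl_Ab //; exact: setmul_verbal_subgroup (generated_subgroup _).
have letters_letter x : x \in flatten [seq word u | u <- X] ->
    {in letters (letter x :: X) &, injective e}.
  move=> xX; apply: sub_in2 e_inj => a;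
    rewrite /letters /= inE => /orP[/eqP->|//].
  exact: map_f.
have memberE x : x \in flatten [seq word u | u <- X] ->
    code_member [seq word_codes e (word u) | u <- X] [:: letter_code e x] <->
    Cl (Ab m) (generated [set` X]) (letter x).
  by move=> /letters_letter/code_memberP.
split=> [/andP[/(all_letters_occur s_uniq sA e_inj) all_X /allP all_C] | dense].
  apply/seteqP; split=> // u _; rewrite -(ev_word u).
  have C_letter a : Cl (Ab m) (generated [set` X]) (letter (a, false)).
    have /mapP[[b d] bX /= ->] := all_X a.
    have : Cl (Ab m) (generated [set` X]) (letter (b, d)).
      apply/memberE => //; apply: all_C.
      have /flattenP[_ /mapP[v vX ->] bv] := bX.
      by apply/flattenP; exists (word_codes e v); apply: map_f.
    by case: d {bX} => //; rewrite (letterN b false); case: C_sub => _ _ CV /CV;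
      rewrite invgK.
  elim: (word u) => [|[a d] w IHw] /=; first by case: C_sub.
  case: (C_sub) => _ CM CV; apply: (CM) => //.
  by case: d => //; rewrite (letterN a false); apply: CV.
apply/andP; split.
  exact/(all_letters_occur s_uniq sA e_inj)/(dense_letters m_gt1).
apply/allP => k /flattenP[_ /mapP[u uX ->] /mapP[x xu ->]].
apply/memberE; first by apply/flattenP; exists (word u) => //; apply: map_f.
by rewrite dense.
Qed.

End CodedMembership.

(** * Partial actions and membership in finitely generated subgroups *)

Section InverseAutomaton.

Context {A : choiceType} {P : Type}.
Local Notation F := (freeGroup A).
Variable step : A * bool -> P -> P -> Prop.
Hypothesis stepV : forall x p q, step (inv_letter x) p q -> step x q p.
Hypothesis step_fun : forall x p q q', step x p q -> step x p q' -> q = q'.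
Implicit Types (w : seq (A * bool)) (p q r : P).

(** Words act from the left, so they are read from their last letter. *)
Fixpoint reads w p q : Prop :=
  if w is x :: w' then exists2 r, reads w' p r & step x r q else p = q.

Lemma reads_cat w1 w2 p q r : reads w2 p q -> reads w1 q r ->
  reads (w1 ++ w2) p r.
Proof.
elim: w1 r => [|x w1 IHw] r /= pq; first by move=> <-.
by move=> [t qt tr]; exists t => //; apply: IHw.
Qed.

Lemma reads_fun w p q q' : reads w p q -> reads w p q' -> q = q'.
Proof.
elim: w q q' => [|x w IHw] q q' /=; first by move=> -> ->.
by move=> [r pr rq] [r' pr' rq']; rewrite (IHw _ _ pr' pr) in rq';
  exact: step_fun rq rq'.
Qed.

Lemma reads_inv w p q : reads w p q -> reads (inv_word w) q p.
Proof.
elim: w q => [|x w IHw] q /=; first by move=> ->.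
move=> [r pr rq]; rewrite /inv_word /= rev_cons -cats1.
apply: reads_cat (IHw _ pr); exists q => //.
by apply: stepV; rewrite inv_letterK.
Qed.

(** Injectivity of the letters makes a path through x and its inverse return to
    its start, so it can be cut out. *)
Lemma reads_reduce w p q : reads w p q -> reads (word (ev w)) p q.
Proof.
elim: w q => //= x w IHw q [r /IHw pr rq]; rewrite -/(ev w).
case: (word (ev w)) pr => [|y w'] /= pr; first by exists r.
case: eqP => [eq_y | _]; last by exists r.
have [t pt] := pr; rewrite eq_y => /stepV xrt.
by rewrite (step_fun rq xrt).
Qed.

Lemma stabilizer_subgroup p : subgroup [set u : F | reads (word u) p p].
Proof.
split=> [//|u v /= up vp|u /=]; last exact: reads_inv.
have := reads_reduce (reads_cat vp up).
by rewrite ev_cat !ev_word.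
Qed.

(** The stabilizer of p contains X, hence the subgroup, and a word leads from p
    to at most one point. *)
Lemma reads_generated (X : seq F) p y q :
  (forall u, u \in X -> reads (word u) p p) ->
  generated [set` X] (ev y) -> reads y p q -> q = p.
Proof.
move=> Xp Xy /reads_reduce yq.
by apply: reads_fun yq (generated_min (stabilizer_subgroup p) Xp Xy).
Qed.

End InverseAutomaton.

Section CodedAutomata.

Implicit Types (E : seq (nat * nat * nat)) (l : seq nat) (S : seq nat)
  (ks : seq nat).

(** An edge (p, k, q) says that the letter named k maps p to q. *)
Definition code_step E (c : nat) S : seq nat :=
  if odd c then [seq t.1.1 | t <- E & (t.1.2 == c./2) && (t.2 \in S)]
  else [seq t.2 | t <- E & (t.1.2 == c./2) && (t.1.1 \in S)].

Definition code_reach E l : seq nat := foldr (code_step E) [:: 0%N] l.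

Definition injective_edges E : bool :=
  all (fun t => all (fun t' =>
    (t.1.2 == t'.1.2) ==> ((t.1.1 == t'.1.1) == (t.2 == t'.2))) E) E.

Definition all_edges (d : nat) ks : seq (nat * nat * nat) :=
  flatten [seq flatten [seq [seq (p, k, q) | q <- iota 0 d] | k <- ks]
          | p <- iota 0 d].

Definition sublists (T : Type) (s : seq T) : seq (seq T) :=
  foldr (fun x L => L ++ [seq x :: t | t <- L]) [:: [::]] s.

Definition words_upto (L : nat) ks : seq (seq nat) :=
  iter L (fun W => [::] :: flatten [seq flatten
    [seq [:: k.*2 :: w; k.*2.+1 :: w] | w <- W] | k <- ks]) [:: [::]].

(** Membership of l in the subgroup generated by c, tested on all partial
    actions of the letters by injections on d points: where the words of c fix
    0, the word l must not move 0. *)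
Definition code_in_subgroup (d : nat) ks (c : seq (seq nat)) (l : seq nat) :
  bool :=
  all (fun E =>
    (injective_edges E && all (fun l' => 0%N \in code_reach E l') c) ==>
    all (fun q => q == 0%N) (code_reach E l)) (sublists (all_edges d ks)).

Lemma filter_sublists (T : eqType) (a : pred T) s : seq.filter a s \in sublists
  s.
Proof.
elim: s => //= x s IHs; rewrite mem_cat; case: (a x); last by rewrite IHs.
by rewrite map_f ?orbT.
Qed.

Lemma computable_sublists (E T : countType) (s : E -> seq T) :
  computable s -> computable (fun x => sublists (s x)).
Proof. by move=> s_comp; rewrite /sublists; computability. Qed.

Lemma computable_code_reach (X : countType) (E : X -> seq (nat * nat * nat))
  (l : X -> seq nat) :
  computable E -> computable l -> computable (fun x => code_reach (E x) (l x)).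
Proof.
move=> E_comp l_comp; rewrite /code_reach /code_step; computability.
by apply: computable_if; computability.
Qed.

Lemma computable_injective_edges (X : countType)
  (E : X -> seq (nat * nat * nat)) :
  computable E -> computable (fun x => injective_edges (E x)).
Proof. by move=> E_comp; rewrite /injective_edges; computability. Qed.

Lemma computable_all_edges (X : countType) (d : X -> nat) (ks : X -> seq nat) :
  computable d -> computable ks -> computable (fun x => all_edges (d x) (ks x)).
Proof. by move=> d_comp ks_comp; rewrite /all_edges; computability. Qed.

Lemma computable_words_upto (X : countType) L (ks : X -> seq nat) :
  computable ks -> computable (fun x => words_upto L (ks x)).
Proof. by move=> ks_comp; rewrite /words_upto; computability. Qed.

Lemma computable_code_in_subgroup (X : countType) (d : X -> nat)
  (ks : X -> seq nat)
    (c : X -> seq (seq nat)) (l : X -> seq nat) :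
  computable d -> computable ks -> computable c -> computable l ->
  computable (fun x => code_in_subgroup (d x) (ks x) (c x) (l x)).
Proof.
move=> d_comp ks_comp c_comp l_comp; rewrite /code_in_subgroup.
have edges_comp := computable_sublists (computable_all_edges d_comp ks_comp).
computability; first by apply: computable_injective_edges; computability.
  by apply: computable_code_reach; computability.
by apply: computable_code_reach; computability.
Qed.

End CodedAutomata.

Section SubgroupMembership.

Context {A : choiceType}.
Variable e : A -> nat.
Hypothesis e_inj : injective e.
Local Notation F := (freeGroup A).
Implicit Types (X : seq F) (w y : seq (A * bool)).

Definition edge_step (E : seq (nat * nat * nat)) (x : A * bool) (p q : nat) :
  Prop :=
  if x.2 then (q, e x.1, p) \in E else (p, e x.1, q) \in E.

Lemma edge_stepV E x p q : edge_step E (inv_letter x) p q -> edge_step E x q p.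
Proof. by case: x => a []. Qed.

Lemma edge_step_fun E x p q q' :
  injective_edges E -> edge_step E x p q -> edge_step E x p q' -> q = q'.
Proof.
move=> /allP inj_E; rewrite /edge_step; case: (x.2) => pq pq'.
  by have /allP/(_ _ pq') := inj_E _ pq; rewrite /= !eqxx eqb_id => /eqP.
by have /allP/(_ _ pq') := inj_E _ pq; rewrite /= !eqxx eq_sym eqb_id => /eqP.
Qed.

Lemma code_reachP E w q :
  q \in code_reach E (word_codes e w) <-> reads (edge_step E) w 0%N q.
Proof.
elim: w q => [|x w IHw] q /=; first by rewrite inE; split=> [/eqP->|->].
rewrite /code_step half_letter_code odd_letter_code /edge_step.
case: (x.2); split.
- move=> /mapP[[[p k] r]];
  rewrite mem_filter /= => /andP[/andP[/eqP-> rw] tE] ->.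
  by exists r => //; apply/IHw.
- move=> [r /IHw rw qr]; apply/mapP; exists (q, e x.1, r) => //.
  by rewrite mem_filter /= eqxx rw.
- move=> /mapP[[[p k] r]];
  rewrite mem_filter /= => /andP[/andP[/eqP-> rw] tE] ->.
  by exists p => //; apply/IHw.
- move=> [r /IHw rw qr]; apply/mapP; exists (r, e x.1, q) => //.
  by rewrite mem_filter /= eqxx rw.
Qed.

Lemma mem_all_edges d ks p k q :
  (p < d)%N -> k \in ks -> (q < d)%N -> (p, k, q) \in all_edges d ks.
Proof.
move=> lt_pd k_ks lt_qd; apply/flatten_mapP; exists p;
  first by rewrite mem_iota.
by apply/flatten_mapP; exists k => //; apply: map_f; rewrite mem_iota.
Qed.

Fixpoint suffixes w : seq (seq (A * bool)) :=
  if w is x :: w' then w :: suffixes w' else [::].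

Lemma size_suffixes w : size (suffixes w) = size w.
Proof. by elim: w => //= x w ->. Qed.

Lemma suffixes_tail x w v : x :: v \in suffixes w -> v \in [::] :: suffixes w.
Proof.
elim: w => //= y w IHw; rewrite inE => /orP[/eqP[_ ->] | /IHw].
  by rewrite !inE; case: w {IHw} => //= z w; rewrite inE eqxx !orbT.
by rewrite !inE => /orP[-> // | ->]; rewrite !orbT.
Qed.

(** The left cosets of the suffixes of some words carry a partial action of the
    letters by injections, and reading a word there leads from the subgroup to
    the coset of that word. *)
Section CosetAutomaton.

Variables (H : set F) (ws : seq (seq (A * bool))).
Hypothesis H_sub : subgroup H.

Definition nodes : seq (seq (A * bool)) := [::] :: flatten (map suffixes ws).

Definition node_index w : nat :=
  find (fun v => `[< same_coset H (ev w) (ev v) >]) nodes.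

Lemma node_index_lt w : w \in nodes -> (node_index w < size nodes)%N.
Proof.
move=> w_node; rewrite -has_find; apply/hasP; exists w => //.
by apply/asboolP; exact: same_coset_refl.
Qed.

Lemma node_indexP w v : w \in nodes -> v \in nodes ->
  node_index w = node_index v <-> same_coset H (ev w) (ev v).
Proof.
move=> /node_index_lt lt_w /node_index_lt lt_v; split=> [eq_wv | wv].
  have has_node u : (node_index u < size nodes)%N ->
      same_coset H (ev u) (ev (nth [::] nodes (node_index u))).
    by rewrite -has_find => /(nth_find [::])/asboolP.
  apply: (same_coset_trans H_sub (has_node _ lt_w)).
  by rewrite eq_wv; apply: (same_coset_sym H_sub); exact: has_node.
apply: eq_find => u; apply/asboolP/asboolP; last exact: same_coset_trans wv.
exact/(same_coset_trans H_sub)/(same_coset_sym H_sub).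
Qed.

Definition coset_edges (d : nat) (ks : seq nat) : seq (nat * nat * nat) :=
  [seq t <- all_edges d ks | `[< exists a u v, [/\ u \in nodes, v \in nodes,
     t = (node_index u, e a, node_index v) &
     same_coset H (letter (a, false) * ev u) (ev v)] >]].

Lemma injective_coset_edges d ks : injective_edges (coset_edges d ks).
Proof.
apply/allP => t;
  rewrite mem_filter => /andP[/asboolP[a [u [v [uN vN -> uv]]]] _].
apply/allP => t';
  rewrite mem_filter => /andP[/asboolP[b [u' [v' [uN' vN' -> uv']]]] _].
apply/implyP => /= /eqP/e_inj eq_ab; rewrite -eq_ab in uv'.
apply/eqP; apply/eqP/eqP => /node_indexP eq_nodes.
  apply/node_indexP => //;
    apply: (same_coset_trans H_sub (same_coset_sym H_sub uv)).
  exact: (same_coset_trans H_sub (same_cosetM _ (eq_nodes uN uN')) uv').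
apply/node_indexP => //.
have := same_coset_trans H_sub (same_coset_trans H_sub uv (eq_nodes vN vN'))
  (same_coset_sym H_sub uv').
by move=> /(same_cosetM (letter (a, false))^-1); rewrite !mulKg.
Qed.

Lemma reads_coset_edges d ks w : (size nodes <= d)%N ->
  (forall a, e a \in ks) ->
  w \in nodes -> reads (edge_step (coset_edges d ks)) w 0%N (node_index w).
Proof.
move=> le_d ksA; have node0 : [::] \in nodes by rewrite mem_head.
elim: w => [_ | x w IHw xw_node].
  by rewrite /node_index /= asboolT //; exact: same_coset_refl.
have w_node : w \in nodes.
  move: xw_node; rewrite inE /= => /flattenP[_ /mapP[v v_ws ->] /suffixes_tail].
  rewrite !inE => /orP[-> // | w_v]; apply/orP; right.
  by apply/flattenP; exists (suffixes v) => //; apply: map_f.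
exists (node_index w); first exact: IHw.
have lt_w := leq_trans (node_index_lt w_node) le_d.
have lt_xw := leq_trans (node_index_lt xw_node) le_d.
rewrite /edge_step; case: x xw_node lt_xw => a [] xw_node lt_xw /=.
  rewrite mem_filter mem_all_edges // andbT; apply/asboolP.
  exists a, ((a, true) :: w), w; split=> //=.
  by rewrite (letter_inv_letterM (a, false)); exact: same_coset_refl.
rewrite mem_filter mem_all_edges // andbT; apply/asboolP.
by exists a, w, ((a, false) :: w); split=> //=; exact: same_coset_refl.
Qed.

End CosetAutomaton.

(** If the word is outside the subgroup, the partial action on cosets refutes
    the test: the word moves the coset numbered 0 to another one. This action
    has at most one point for the empty word and one for each nonempty suffix,
    which gives the bound d. *)
Lemma code_in_subgroupP (d : nat) (ks : seq nat) (X : seq F)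
  (y : seq (A * bool)) :
  (forall a, e a \in ks) ->
    (size (flatten [seq word u | u <- X]) + size y < d)%N ->
  code_in_subgroup d ks [seq word_codes e (word u) | u <- X] (word_codes e y)
    <->
  generated [set` X] (ev y).
Proof.
move=> ksA lt_d; set H := generated [set` X].
have H_sub : subgroup H by exact: generated_subgroup.
split=> [/allP all_E | Hy]; last first.
  apply/allP => E _; apply/implyP => /andP[inj_E /allP loops].
  apply/allP => q /code_reachP y_q; apply/eqP.
  apply: (reads_generated (@edge_stepV E) (fun x p q q' => edge_step_fun inj_E)
    _ Hy y_q).
  by move=> u uX; apply/code_reachP/loops; apply: map_f.
pose ws := y :: map (@word A) X; pose E := coset_edges H ws d ks.
have le_d : (size (nodes ws) <= d)%N.
  rewrite /= size_cat size_suffixes size_flatten /shape -map_comp.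
  rewrite (leq_ltn_trans _ lt_d) // addnC leq_add2r size_flatten /shape
    -!map_comp.
  by rewrite (eq_map (g := fun u : F => size (word u))) // => u;
    rewrite /= size_suffixes.
have wsN w : w \in ws -> w \in nodes ws.
  case: w => [_|x w w_ws]; first exact: mem_head.
  rewrite inE; apply/orP; right; apply/flattenP.
  by exists (suffixes (x :: w)); rewrite ?mem_head //; exact: map_f.
have reads_node w : w \in ws -> reads (edge_step E) w 0%N (node_index H ws w).
  by move=> w_ws; apply: reads_coset_edges => //; exact: wsN.
have index0 : node_index H ws [::] = 0%N.
  by rewrite /node_index /= asboolT //; exact: same_coset_refl.
have index0P w : w \in ws -> node_index H ws w = 0%N <-> H (ev w).
  move=> w_ws; rewrite -index0 node_indexP ?mem_head //; last exact: wsN.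
  rewrite /same_coset mulg1; case: (H_sub) => _ _ HV.
  by split=> [/HV | Hw]; [rewrite invgK | exact: HV].
apply/(index0P y); first exact: mem_head.
have := all_E E (filter_sublists _ _); rewrite injective_coset_edges //=.
have -> : all (fun l => 0%N \in code_reach E l)
  [seq word_codes e (word u) | u <- X].
  apply/allP => _ /mapP[u uX ->]; apply/code_reachP.
  have u_ws : word u \in ws by rewrite inE map_f ?orbT.
  rewrite -[X in reads _ _ _ X](_ : node_index H ws (word u) = 0%N);
    first exact: reads_node.
  by apply/index0P => //; rewrite ev_word; apply: sub_generated.
move=> /allP all_y; apply/eqP; apply: all_y; apply/code_reachP;
  apply: reads_node.
exact: mem_head.
Qed.

End SubgroupMembership.

(** * Closedness *)

Section Closedness.

Variable m' : nat.
Local Notation m := m'.+1.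

(** Over a finite alphabet the verbal subgroup is generated by its words up to
    some length L, and the subgroup is closed when it contains these. The zeros
    are there to make room for the suffixes of a word of length L. *)
Definition code_closed (n L : nat) (c : seq (seq nat)) : bool :=
  (size (undup (map half (flatten c))) == n) &&
  all (fun l =>
    all (fun k => code_exp m' k l == ord0) (map half (flatten c)) ==>
    code_in_subgroup (size (nseq L.+1 0%N ++ flatten c))
      (map half (flatten c)) c l)
  (words_upto L (map half (flatten c))).

Lemma computable_code_closed (E : countType) n L (c : E -> seq (seq nat)) :
  computable c -> computable (fun x => code_closed n L (c x)).
Proof.
move=> c_comp; rewrite /code_closed; computability.
- by apply: computable_code_exp; computability.
- by apply: computable_code_in_subgroup; computability.
- by apply: computable_words_upto; computability.
Qed.

Context {A : choiceType}.
Local Notation F := (freeGroup A).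

Lemma mem_words_upto (e : A -> nat) L ks (w : seq (A * bool)) :
  (size w <= L)%N -> (forall a, e a \in ks) ->
    word_codes e w \in words_upto L ks.
Proof.
move=> + ksA; elim: L w => [|L IHL] [|[a b] w] //= le_wL; rewrite inE //.
apply/orP; right; apply/flatten_mapP; exists (e a) => //.
apply/flatten_mapP; exists (word_codes e w); first exact: IHL.
by rewrite !inE /letter_code; case: b => /=; rewrite ?addn1 ?addn0 eqxx ?orbT.
Qed.

Lemma words_uptoP (e : A -> nat) L ks l :
  (forall k, k \in ks -> exists a, k = e a) -> l \in words_upto L ks ->
  exists2 w : seq (A * bool), (size w <= L)%N & l = word_codes e w.
Proof.
move=> ksA; elim: L l => [|L IHL] l /=; first by rewrite inE => /eqP->;
  exists [::].
rewrite inE => /orP[/eqP->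
  | /flatten_mapP[k /ksA[a ->] /flatten_mapP[_ /IHL[w le_wL ->]]]].
  by exists [::].
by rewrite !inE => /orP[]/eqP->;
  [exists ((a, false) :: w) | exists ((a, true) :: w)];
  rewrite //= /letter_code ?addn0 ?addn1.
Qed.

Lemma closed_verbal (H : set F) : subgroup H -> fin_gen H ->
  Vclosed (Ab m) H <-> verbal m `<=` H.
Proof.
move=> H_sub H_fg; rewrite /Vclosed Cl_Ab //; split=> [<- | VH].
  exact: verbal_sub_setmul.
apply/seteqP; split=> [_ [h Hh [v Vv <-]] | h Hh].
  by case: H_sub => _ HM _; apply: HM => //; exact: VH.
by exists h => //; exists 1;
  [case: (verbal_subgroup (G := F) m) | rewrite mulg1].
Qed.

Lemma code_closedP (s : seq A) : uniq s -> (forall a, a \in s) ->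
  exists L, forall (X : seq F) (e : A -> nat), {in letters X &, injective e} ->
    code_closed (size s) L [seq word_codes e (word u) | u <- X] <->
    Vclosed (Ab m) (generated [set` X]).
Proof.
move=> s_uniq sA.
have A_fin : finite_set [set: A].
  by apply/finite_seqP; exists s; apply/seteqP; split=> a //= _; exact: sA.
have [_ /(_ A_fin)[Y eq_Y]] := fin_gen_verbal (verbal_subgroup m)
  (@subset_refl _ (@verbal F m)).
pose L := \max_(y <- Y) size (word y); exists L => X e e_inX.
rewrite closed_verbal; [|exact: generated_subgroup|by exists X].
pose ks := map half (flatten [seq word_codes e (word u) | u <- X]).
have eq_ks : ks = map e (letters X) := names_codes e X.
rewrite /code_closed -/ks.
have codesP : (forall a, a \in letters X) -> forall w : seq (A * bool),
  (size w <= L)%N ->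
    [/\ word_codes e w \in words_upto L ks,
        all (fun k => code_exp m' k (word_codes e w) == ord0) ks <->
          verbal m (ev w) &
        code_in_subgroup
          (size (nseq L.+1 0%N ++ flatten [seq word_codes e (word u) | u <- X]))
          ks [seq word_codes e (word u) | u <- X] (word_codes e w) <->
        generated [set` X] (ev w)].
  move=> XA w le_wL; have e_inj : injective e by move=> a b; apply: e_inX.
  have ksA a : e a \in ks by rewrite eq_ks map_f.
  have expE a : code_exp m' (e a) (word_codes e w) = exp_sum m' a w.
    by apply: code_exp_codes => b b' _ _; exact: e_inj.
  split; first exact: mem_words_upto.
    rewrite verbalP eq_ks; split=> [/allP w0 a | w0].
      rewrite /exp_sum weight_ev -/(exp_sum m' a w) -expE; apply/eqP/w0.
      exact: map_f.
    by apply/allP => _ /mapP[a _ ->]; apply/eqP; rewrite expE; have := w0 a;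
      rewrite /exp_sum weight_ev.
  apply: code_in_subgroupP => //;
    rewrite size_cat size_nseq addSn ltnS addnC leq_add //.
  by rewrite -(size_map (letter_code e)) map_flatten -map_comp.
split=> [/andP[/(all_letters_occur s_uniq sA e_inX) XA /allP all_w] | VX].
  rewrite eq_Y; apply: generated_min => [|y yY];
    first exact: generated_subgroup.
  have [|w_in wV wX] := codesP XA (word y); first exact: leq_bigmax_seq.
  rewrite -(ev_word y); apply/wX; apply: (implyP (all_w _ w_in)); apply/wV.
  by rewrite ev_word eq_Y; exact: sub_generated.
have XA := verbal_letters VX.
apply/andP; split; first exact/(all_letters_occur s_uniq sA e_inX).
apply/allP => l /(words_uptoP (e := e))[|w le_wL ->].
  by move=> k; rewrite eq_ks => /mapP[a _ ->]; exists a.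
have [_ wV wX] := codesP XA w le_wL.
by apply/implyP => /wV/VX/wX.
Qed.

End Closedness.

(** * Decidability and computability *)

Section Algorithms.

Variable m' : nat.
Local Notation m := m'.+1.
Context {A : choiceType}.
Local Notation F := (freeGroup A).

Lemma decidable_computable (P : set F -> Prop) (b : seq (seq nat) -> bool) :
  computable (fun c => b c) ->
  (forall X e, {in letters X &, injective e} ->
     b [seq word_codes e (word u) | u <- X] <-> P (generated [set` X])) ->
  decidable_subgroups P.
Proof.
move=> b_comp bP;
  have [|f [f_rec fE]] := @computable_unary _ (fun c => nat_of_bool (b c)).
  exact: computable_finfun.
exists f; split=> // X e e_inj; rewrite -(bP X e e_inj) -pickle_elts_codes fE.
by case: (b _).
Qed.

Lemma closure_fin_gen (H : set F) : subgroup H -> fin_gen H ->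
  fin_gen (Cl (Ab m) H) <-> finite_set [set: A].
Proof.
move=> H_sub H_fg; rewrite Cl_Ab //; apply: (@fin_gen_verbal _ m').
  exact: setmul_verbal_subgroup.
exact: verbal_sub_setmul.
Qed.

Lemma closure_fin_gen_decidable :
  decidable_subgroups (fun H : set F => fin_gen (Cl (Ab m) H)).
Proof.
apply: (@decidable_computable _ (fun=> `[< finite_set [set: A] >])) => [|X e _].
  exact: computable_const.
rewrite closure_fin_gen;
  [by split=> /asboolP|exact: generated_subgroup|by exists X].
Qed.

(** The input is reduced to its set of rows, for which a code of a basis is
    looked up. *)
Lemma closure_basis_computable :
  computable_basis (fun H : set F => fin_gen (Cl (Ab m) H)) (@Cl (Ab m) F).
Proof.
move=> e e_inj; have [A_fin | A_inf] := pselect (finite_set [set: A]);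
  last first.
  exists (fun=> 0%N); split=> [|X]; first exact: rec_zero.
  have [fgA _] := closure_fin_gen (generated_subgroup [set` X])
    (ex_intro _ X erefl).
  by move=> /fgA/A_inf.
have [s _ sA] := finite_enumeration A_fin.
pose T (c : seq (seq nat)) := code_elts e
  (rows_basis e_inj sA (code_rows m' e s c)).
have [|f [f_rec fE]] := @computable_unary _ T.
  apply: (computable_finfun (fun S => code_elts e (rows_basis e_inj sA S))).
  by apply: computable_code_rows; computability.
exists f; split=> // X _; exists (rows_basis e_inj sA (gen_rows m' s X)); split.
- by rewrite -pickle_elts_codes fE /T code_rows_elts.
- exact: rows_basis_uniq.
by rewrite Cl_Ab; [exact: rows_basis_free | exists X].
Qed.

Lemma closure_rewriting_computable :
  finite_set [set: A] -> re_basis_rewriting (@Cl (Ab m) F).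
Proof.
move=> A_fin e e_inj; have [s _ sA] := finite_enumeration A_fin.
pose T (p : seq (seq nat) * nat) :=
  nth 0%N [seq (code_elt e b).+1 | b <- rows_basis e_inj sA
    (code_rows m' e s p.1)] p.2.
have [|enum [enum_rec enumE]] := @computable_binary _ _ T.
  apply: computable_nth; last by computability.
  apply: (computable_finfun
    (fun S => [seq (code_elt e b).+1 | b <- rows_basis e_inj sA S])).
  by apply: computable_code_rows; computability.
pose R (p : seq (seq nat) * seq nat) :=
  pickle (row_rewriting e (code_rows m' e s p.1) p.2).2.
have [|expr [expr_rec exprE]] := @computable_binary _ _ R.
  apply/computable_pickle/computable_row_rewriting; last by computability.
  by apply: computable_code_rows; computability.
exists enum, expr; split=> //; split=> // X.
exists [set` rows_basis e_inj sA (gen_rows m' s X)]; split.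
- by rewrite Cl_Ab; [exact: rows_basis_free | exists X].
- apply/seteqP; split=> k /=.
    move=> [b bB <-]; exists (index b (rows_basis e_inj sA (gen_rows m' s X))).
    rewrite -pickle_elts_codes -[X in [tuple _; X]]pickle_nat enumE /T
      /= code_rows_elts //.
    by rewrite (nth_map b) ?index_mem // nth_index.
  move=> [n]; rewrite -pickle_elts_codes -[X in [tuple _; X]]pickle_nat enumE /T
    /= code_rows_elts //.
  have [lt_n | le_n] := ltnP n (size (rows_basis e_inj sA (gen_rows m' s X))).
    by rewrite (nth_map 1) // => -[<-];
      exists (nth 1 (rows_basis e_inj sA (gen_rows m' s X)) n) => //;
      exact: mem_nth.
  by rewrite nth_default ?size_map.
move=> w; rewrite Cl_Ab; last by exists X.
rewrite -/(closure_of m' X) -(closure_some_gens m' sA) => Cw.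
exists (rewriting e (rows_subgroup (gen_rows m' s X)) 1 (word w)); split.
- by rewrite rows_basisE; exact: word_on_rewriting.
- by apply: rewritingP; [exact: e_inj | exact: Cw].
rewrite -pickle_elts_codes -[code_elt e w]pickle_word_codes exprE /R
  /= code_rows_elts //.
by rewrite row_rewriting_codes // -pickle_word_codes.
Qed.

Lemma closed_decidable : decidable_subgroups
  (fun H : set F => Vclosed (Ab m) H).
Proof.
have [A_fin | A_inf] := pselect (finite_set [set: A]); last first.
  (* Closures are not finitely generated here, so none of the given subgroups is
     closed. *)
  apply: (@decidable_computable _ (fun=> false)) => [|X e _];
    first exact: computable_const.
  split=> // closed; case: A_inf.
  have [fg _] := closure_fin_gen (generated_subgroup [set` X])
    (ex_intro _ X erefl).
  by apply: fg; rewrite closed; exists X.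
have [s s_uniq sA] := finite_enumeration A_fin.
have [L closedP] := code_closedP m' s_uniq sA.
apply: (@decidable_computable _ (code_closed m' (size s) L)) => [|X e e_inj].
  by apply: computable_code_closed; computability.
exact: closedP.
Qed.

Lemma dense_decidable : decidable_subgroups (fun H : set F => Vdense (Ab m) H).
Proof.
have [m0 | m_gt0] := posnP m'.
  (* For m = 1 the verbal subgroup is the whole group. *)
  apply: (@decidable_computable _ (fun=> true)) => [|X e _];
    first exact: computable_const.
  split=> // _; apply/seteqP; split=> // u _; rewrite Cl_Ab; last by exists X.
  apply: (verbal_sub_setmul (generated_subgroup _)); apply/verbalP => a.
  by move: (exp_sum _ _ _); rewrite m0 => i; apply: ord1.
have [A_fin | A_inf] := pselect (finite_set [set: A]); last first.
  (* Every letter would have to occur in the finitely many generators. *)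
  apply: (@decidable_computable _ (fun=> false)) => [|X e _];
    first exact: computable_const.
  split=> // /(dense_letters m_gt0) XA; case: A_inf.
  by apply/finite_seqP; exists (letters X); apply/seteqP; split=> a //= _;
    exact: XA.
have [s s_uniq sA] := finite_enumeration A_fin.
apply: (@decidable_computable _ (code_dense m' (size s))) => [|X e e_inj].
  by apply: computable_code_dense; computability.
exact: code_denseP.
Qed.

Lemma dense_primes (H : set F) : subgroup H -> fin_gen H ->
  Vdense (Ab m) H <-> forall p, prime p -> (p %| m)%N -> Vdense (Ab p) H.
Proof.
move=> H_sub H_fg; rewrite /Vdense Cl_Ab // setmul_verbal_primes //.
split=> dense p p_prime p_m; have := dense p p_prime p_m;
  rewrite -(prednK (prime_gt0 p_prime)).
  by rewrite Cl_Ab.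
by rewrite Cl_Ab.
Qed.

End Algorithms.

Theorem theorem5p1 (m : nat) (A : choiceType) (m_gt0 : (0 < m)%N) :
  let F := freeGroup A in
  let ClAb (d : nat) (H : set F) := Cl (Ab d) H in
  (forall H : set F, subgroup H -> fin_gen H ->
     ClAb m H = setmul (setmul H derived) (powers m)) /\
  (forall H : set F, subgroup H -> fin_gen H ->
     fin_gen (ClAb m H) <-> finite_set [set: A]) /\
  decidable_subgroups (fun H : set F => fin_gen (ClAb m H)) /\
  computable_basis (fun H : set F => fin_gen (ClAb m H)) (ClAb m) /\
  decidable_subgroups (fun H : set F => Vclosed (Ab m) H) /\
  (forall H : set F, subgroup H -> fin_gen H ->
     Vdense (Ab m) H <->
     forall p : nat, prime p -> (p %| m)%N -> Vdense (Ab p) H) /\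
  decidable_subgroups (fun H : set F => Vdense (Ab m) H) /\
  decidable_membership (ClAb m) /\
  (finite_set [set: A] -> re_basis_rewriting (ClAb m)).
Proof.
case: m m_gt0 => // m' _ F ClAb; split.
  by move=> H _ H_fg; rewrite /ClAb Cl_Ab // setmulA.
split; first by move=> H; exact: closure_fin_gen.
split; first exact: closure_fin_gen_decidable.
split; first exact: closure_basis_computable.
split; first exact: closed_decidable.
split; first by move=> H; exact: dense_primes.
split; first exact: dense_decidable.
split; first exact: closure_member_decidable.
exact: closure_rewriting_computable.
Qed.
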